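(* Let $1\le p<q\le\infty$ and let $r=\frac{pq}{q-p}$, i.e. $\frac1r=\frac1p-\frac1q$ (so $r=p$ if $q=\infty$). Then $$\lim_{\varepsilon\to0}\left(\lim_{n\to\infty}\frac{\log\mathrm{Widim}_\varepsilon\big(B_{\ell^p}(\mathbb{R}^n),d_{\ell^q}\big)}{|\log\varepsilon|}\right)=r.$$ Here the limit $\lim_{n\to\infty}\log\mathrm{Widim}_\varepsilon(B_{\ell^p}(\mathbb{R}^n),d_{\ell^q})$ exists, because $\mathrm{Widim}_\varepsilon(B_{\ell^p}(\mathbb{R}^n),d_{\ell^q})$ is monotone non-decreasing in $n$ and has an upper bound independent of $n$.
   Context: For a compact metric space $(X,d)$, a topological space $Y$ and $\varepsilon>0$, a continuous map $f:X\to Y$ is called an $\varepsilon$-embedding if $\mathrm{Diam}\, f^{-1}(y)\le\varepsilon$ for all $y\in Y$ (diameter with respect to $d$). $\mathrm{Widim}_\varepsilon(X,d)$ is the minimum integer $k\ge 0$ such that there exist a $k$-dimensional polyhedron $P$ (the underlying topological space of a $k$-dimensional simplicial complex) and an $\varepsilon$-embedding $f:X\to P$. For $1\le p<\infty$, $B_{\ell^p}(\mathbb{R}^n)=\{x\in\mathbb{R}^n : \sum_{k=1}^n|x_k|^p\le1\}$. For $1\le q<\infty$, $d_{\ell^q}(x,y)=\big(\sum_{k=1}^n|x_k-y_k|^q\big)^{1/q}$, and $d_{\ell^\infty}(x,y)=\max_{1\le k\le n}|x_k-y_k|$. The convention $1/\infty=0$ is used. The limit $\varepsilon\to0$ is over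 positive $\varepsilon$, so only small $\varepsilon$ are relevant. *)

(* Defs.v *)
From HB Require Import structures.
From mathcomp Require Import all_boot all_order all_algebra finmap.
From mathcomp Require Import all_classical all_reals all_analysis.
Set Implicit Arguments.
Unset Strict Implicit.
Unset Printing Implicit Defensive.
Import Order.TTheory GRing.Theory Num.Theory.
Import numFieldNormedType.Exports.
Local Open Scope classical_set_scope.
Local Open Scope ring_scope.

(* Abstract simplicial complexes, possibly infinite; the actual vertices are
   the v such that [fset v] is a simplex. *)
Record simplicial_complex (V : choiceType) := SimplicialComplex {
  simplices : set {fset V};
  simplex_neq0 : ~ simplices fset0;
  simplex_sub : forall s t : {fset V},
    simplices s -> t != fset0 -> (t `<=` s)%fset -> simplices t }.

Definition has_dimension (V : choiceType) (K : simplicial_complex V) (k : nat) :=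
  (forall s, simplices K s -> (#|` s| <= k.+1)%N) /\
  (exists2 s, simplices K s & #|` s| = k.+1).

(* The points of |K|, in barycentric coordinates. *)
Record polyhedron (R : realType) (V : choiceType) (K : simplicial_complex V) :=
  Polyhedron {
  bary :> V -> R;
  bary_ge0 : forall v, 0 <= bary v;
  bary_simplex : exists2 s, simplices K s &
    (forall v, v \notin s -> bary v = 0) /\ \sum_(v <- s) bary v = 1 }.
Arguments polyhedron : clear implicits.

HB.instance Definition _ R V K := gen_eqMixin (@polyhedron R V K).
HB.instance Definition _ R V K := gen_choiceMixin (@polyhedron R V K).

Section polyhedron_topology.
Context (R : realType) (V : choiceType) (K : simplicial_complex V).
Local Notation P := (polyhedron R V K).

Definition closed_face (s : {fset V}) : set P :=
  [set x | forall v, v \notin s -> x v = 0].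

(* The coherent (weak) topology: U is open iff its trace on each closed face is
   open for the Euclidean topology of that face. *)
Definition polyhedron_open (U : set P) := forall s, simplices K s ->
  forall x, closed_face s x -> U x ->
  exists2 e : R, 0 < e & forall y, closed_face s y ->
    (forall v, v \in s -> `|x v - y v| < e) -> U y.

Let openT : polyhedron_open setT.
Proof. by move=> s _ x _ _; exists 1. Qed.

Let openI : setI_closed polyhedron_open.
Proof.
move=> A B oA oB s Ks x sx [Ax Bx].
have [a a0 aA] := oA s Ks x sx Ax; have [b b0 bB] := oB s Ks x sx Bx.
exists (Num.min a b); first by rewrite lt_min a0.
move=> y sy xy; split; [apply: aA => // v vs | apply: bB => // v vs];
  by have := xy v vs; rewrite lt_min => /andP[].
Qed.

Let open_bigU (I : Type) (f : I -> set P) :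
  (forall i, polyhedron_open (f i)) -> polyhedron_open (\bigcup_i f i).
Proof.
move=> fo s Ks x sx [i _ fix_]; have [e e0 eU] := fo i s Ks x sx fix_.
by exists e => // y sy xy; exists i => //; exact: eU.
Qed.

HB.instance Definition _ := isOpenTopological.Build P openT openI open_bigU.
End polyhedron_topology.

Section widim.
Context (R : realType).

Definition diam (X : metricType R) (A : set X) : \bar R :=
  ereal_sup [set (mdist xy.1 xy.2)%:E | xy in A `*` A].

Definition eps_embedding (X : metricType R) (Y : topologicalType) (eps : R)
    (f : X -> Y) :=
  continuous f /\ forall y, (diam (f @^-1` [set y]) <= eps%:E)%E.

Definition embeds_in_dim (X : metricType R) (eps : R) (k : nat) :=
  exists (V : choiceType) (K : simplicial_complex V),
    has_dimension K k /\
    exists f : X -> polyhedron R V K, eps_embedding eps f.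

(* The least k such that embeds_in_dim X eps k, and +oo if there is none;
   see widimP. *)
Definition widim (X : metricType R) (eps : R) : \bar R :=
  ereal_inf [set k%:R%:E | k in embeds_in_dim X eps].

Lemma widimP (X : metricType R) (eps : R) (k : nat) :
  widim X eps = k%:R%:E <->
  embeds_in_dim X eps k /\ forall j, embeds_in_dim X eps j -> (k <= j)%N.
Proof.
have min_widim m : embeds_in_dim X eps m ->
    (forall j, embeds_in_dim X eps j -> (m <= j)%N) ->
    widim X eps = m%:R%:E.
  move=> Em mmin; apply/eqP; rewrite eq_le; apply/andP; split.
    by apply: ereal_inf_lbound; exists m.
  apply: le_ereal_inf_tmp => _ [j Ej <-].
  by rewrite lee_fin ler_nat; exact: mmin.
split=> [Wk|[]]; last exact: min_widim.
have [[j Ej]|nE] := pselect (exists j, embeds_in_dim X eps j); last first.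
  have E0 : embeds_in_dim X eps = set0.
    by rewrite -subset0 => j Ej; apply: nE; exists j.
  by move: Wk; rewrite /widim E0 image_set0 ereal_inf0.
have exE : exists j, `[< embeds_in_dim X eps j >] by exists j; exact/asboolP.
case: (ex_minnP exE) => m /asboolP Em mmin.
have mmin' i : embeds_in_dim X eps i -> (m <= i)%N by move/asboolP/mmin.
have := min_widim m Em mmin'; rewrite Wk => -[] /eqP.
by rewrite eqr_nat => /eqP ->.
Qed.

End widim.

Section lp_ball.
Context (R : realType).

(* The value at q = -oo is irrelevant. *)
Definition lq_dist (q : \bar R) (n : nat) (x y : 'rV[R]_n) : R :=
  match q with
  | q0%:E%E => (\sum_(k < n) `|x ord0 k - y ord0 k| `^ q0) `^ q0^-1
  | +oo%E => \big[Num.max/0]_(k < n) `|x ord0 k - y ord0 k|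
  | -oo%E => 0
  end.

(* B_{l^p}(R^n), to be equipped with the distance of l^q, hence the phantom
   parameters q and q1. *)
Record lp_ball (p : R) (q : \bar R) (q1 : (1 <= q)%E) (n : nat) := LpBall {
  lp_val :> 'rV[R]_n;
  lp_valP : \sum_(k < n) `|lp_val ord0 k| `^ p <= 1 }.

HB.instance Definition _ p q (q1 : (1 <= q)%E) n :=
  [isSub for @lp_val p q q1 n].
HB.instance Definition _ p q (q1 : (1 <= q)%E) n :=
  [Choice of lp_ball p q1 n by <:].

Lemma minkowski_sum (q : R) (n : nat) (x y : 'I_n -> R) : 1 <= q ->
  (\sum_k `|x k + y k| `^ q) `^ q^-1 <=
  (\sum_k `|x k| `^ q) `^ q^-1 + (\sum_k `|y k| `^ q) `^ q^-1.
Proof.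
move=> q1; have q0 : 0 < q by exact: lt_le_trans q1.
have qn0 : q != 0 by rewrite gt_eqF.
have sum_ge0 (z : 'I_n -> R) : 0 <= \sum_k `|z k| `^ q.
  by apply: sumr_ge0 => k _; exact: powR_ge0.
have rootK (z : R) : 0 <= z -> (z `^ q^-1) `^ q = z.
  by move=> z0; rewrite -powRrM mulVf// powRr1.
have eq0 (z : 'I_n -> R) : (\sum_k `|z k| `^ q) `^ q^-1 = 0 -> forall k, z k = 0.
  move=> /(congr1 (fun t => t `^ q)); rewrite rootK// powR0// => /eqP.
  rewrite psumr_eq0; last by move=> *; exact: powR_ge0.
  by move=> /allP zE k; have := zE k (mem_index_enum _);
    rewrite powR_eq0 normr_eq0 => /andP[/eqP].
set a := (\sum_k `|x k| `^ q) `^ q^-1; set b := (\sum_k `|y k| `^ q) `^ q^-1.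
have [a0|a0] := eqVneq a 0.
  by rewrite a0 add0r; under eq_bigr do rewrite (eq0 _ a0) add0r.
have [b0|b0] := eqVneq b 0.
  by rewrite b0 addr0; under eq_bigr do rewrite (eq0 _ b0) addr0.
have {}a0 : 0 < a by rewrite lt_neqAle eq_sym a0 powR_ge0.
have {}b0 : 0 < b by rewrite lt_neqAle eq_sym b0 powR_ge0.
have aq : a `^ q = \sum_k `|x k| `^ q by rewrite rootK.
have bq : b `^ q = \sum_k `|y k| `^ q by rewrite rootK.
clearbody a b.
have ab0 : 0 < a + b by exact: addr_gt0.
rewrite -[leRHS]powRr1 ?(ltW ab0)// -(mulfV qn0) powRrM.
rewrite ge0_ler_powR ?invr_ge0 ?(ltW q0) ?nnegrE ?powR_ge0//.
pose t := a / (a + b).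
have t01 : 0 <= t <= 1.
  by rewrite /t divr_ge0 ?(ltW a0) ?(ltW ab0)//= ler_pdivrMr// mul1r lerDl ltW.
have tE : 1 - t = b / (a + b).
  by rewrite -[X in X - _](mulfV (lt0r_neq0 ab0)) -mulrBl addrC addKr.
have step k : `|x k + y k| `^ q <= (a + b) `^ q *
    (t * (`|x k| / a) `^ q + (1 - t) * (`|y k| / b) `^ q).
  have : (t * (`|x k| / a) + (1 - t) * (`|y k| / b)) `^ q <=
      t * (`|x k| / a) `^ q + (1 - t) * (`|y k| / b) `^ q.
    have /andP[t0 t1] := t01.
    have := @convex_powR R q q1 (Itv01 t0 t1) (`|x k| / a) (`|y k| / b).
    rewrite !convRE/= /unstable.onem; apply; rewrite inE/= in_itv/= andbT.
      by rewrite divr_ge0// ltW.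
    by rewrite divr_ge0// ltW.
  move=> /(ler_wpM2l (powR_ge0 (a + b) q)); apply: le_trans.
  have mix_ge0 : 0 <= t * (`|x k| / a) + (1 - t) * (`|y k| / b).
    by rewrite tE; apply: addr_ge0; apply: mulr_ge0; apply: divr_ge0; rewrite // ltW.
  rewrite -powRM ?(ltW ab0)//.
  apply: ge0_ler_powR; rewrite ?nnegrE ?(ltW q0) ?normr_ge0//.
    by apply: mulr_ge0; rewrite // ltW.
  have scale (c z : R) : 0 < c -> (a + b) * (c / (a + b) * (z / c)) = z.
    move=> c0; rewrite mulrA [_ * (c / _)]mulrC divfK ?gt_eqF//.
    by rewrite mulrCA mulfV ?mulr1 ?gt_eqF.
  by rewrite tE mulrDr !scale// ler_normD.
apply: le_trans (ler_sum _ (fun k _ => step k)) _.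
rewrite -mulr_sumr big_split/= -!mulr_sumr.
have normalize (z : 'I_n -> R) c : 0 < c -> c `^ q = \sum_k `|z k| `^ q ->
    \sum_k (`|z k| / c) `^ q = 1.
  move=> c0 cq; under eq_bigr do rewrite powRM ?invr_ge0 ?(ltW c0)//.
  by rewrite -mulr_suml -cq -powRM ?invr_ge0 ?(ltW c0)// mulfV ?gt_eqF// powR1.
by rewrite !normalize// !mulr1 addrC subrK mulr1.
Qed.

Section metric.
Context (q : \bar R) (q1 : (1 <= q)%E) (n : nat).
Implicit Types x y z : 'rV[R]_n.

Lemma lq_distxx x : lq_dist q x x = 0.
Proof.
case: q q1 => [q0| |]//= h.
- have q0n : q0 != 0 by rewrite gt_eqF// -lte_fin (lt_le_trans _ h)// lte01.
  rewrite big1 ?powR0 ?invr_eq0// => k _.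
  by rewrite subrr normr0 powR0.
- apply: (@big_ind _ (fun d => d = 0)) => // [_ _ -> ->|k _].
    by rewrite maxxx.
  by rewrite subrr normr0.
Qed.

Lemma lq_dist_eq0 x y : lq_dist q x y = 0 -> x = y.
Proof.
move=> d0; apply/rowP => k.
apply/eqP; rewrite -subr_eq0 -normr_le0.
case: q q1 d0 => [q0| |]//= h.
- move/eqP; rewrite powR_eq0 => /andP[+ _].
  rewrite psumr_eq0; last by move=> *; exact: powR_ge0.
  by move=> /allP /(_ k (mem_index_enum _)); rewrite /= powR_eq0 => /andP[/eqP ->].
- by move=> <-; exact: le_bigmax.
Qed.

Lemma lq_distC x y : lq_dist q x y = lq_dist q y x.
Proof.
case: q q1 => [q0| |] _ /=; last by [].
- by congr powR; apply: eq_bigr => k _; rewrite distrC.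
- by apply: eq_bigr => k _; rewrite distrC.
Qed.

Lemma lq_dist_triangle y x z : lq_dist q x z <= lq_dist q x y + lq_dist q y z.
Proof.
case: q q1 => [q0| |]//= h.
- have -> : \sum_k `|x ord0 k - z ord0 k| `^ q0 =
      \sum_k `|(x ord0 k - y ord0 k) + (y ord0 k - z ord0 k)| `^ q0.
    by apply: eq_bigr => k _; rewrite addrA subrK.
  exact: (minkowski_sum (fun k => x ord0 k - y ord0 k)
                        (fun k => y ord0 k - z ord0 k)).
- apply/bigmax_leP; split=> [|k _].
    by rewrite addr_ge0// bigmax_ge_id.
  apply: le_trans (ler_distD (y ord0 k) _ _) _.
  by apply: lerD; [exact: (le_bigmax _ (fun k => `|x ord0 k - y ord0 k|)) |
    exact: (le_bigmax _ (fun k => `|y ord0 k - z ord0 k|))].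
Qed.

End metric.

HB.instance Definition _ (p : R) (q : \bar R) (q1 : (1 <= q)%E) (n : nat) :=
  isMetric.Build R (lp_ball p q1 n)
    (fun x => lq_distxx q1 x) (fun x y d => val_inj (lq_dist_eq0 q1 d))
    (fun x y => lq_distC q1 x y) (fun y x z => lq_dist_triangle q1 y x z).

Lemma exponent_ge1 (p : R) (q : \bar R) :
  1 <= p -> (p%:E < q)%E -> (1 <= q)%E.
Proof. by move=> p1 /ltW; apply: le_trans; rewrite lee_fin. Qed.

(* pq / (q - p), for p < q; the value at q = -oo is irrelevant. *)
Definition growth_exponent (p : R) (q : \bar R) : R :=
  match q with
  | q0%:E%E => p * q0 / (q0 - p)
  | +oo%E => p
  | -oo%E => 0
  end.

End lp_ball.

(* Main.v *)
(** Idea.  Soft-thresholding the coordinates of a point of the l^p ball at a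
    small height t leaves at most t^-p of them nonzero, and moves the point by
    at most t^(1 - p/q) in l^q; this gives an upper bound of order eps^-r.  For
    the lower bound, on R^n with n of order eps^-r an l^q distance at most eps
    forces an l^p distance less than some constant d < 1.  An eps-embedding f
    into a k-dimensional polyhedron then yields, by a partition of unity in
    finitely many barycentric coordinates, a Lipschitz function g of these
    coordinates such that g o f moves points of the l^p ball by at most a
    constant less than 1.  By Brouwer's theorem the image of g o f contains a
    small cube of R^n; since at most k+1 barycentric coordinates are nonzero,
    counting the points of a fine grid gives n <= k+1.  Brouwer's theorem is
    obtained from Scarf's lemma on families of linear orders, so that no
    triangulation is needed. *)

Require Import Defs.
From HB Require Import structures.
From mathcomp Require Import all_boot zify.
Set Implicit Arguments.
Unset Strict Implicit.
Unset Printing Implicit Defensive.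

(** * Scarf's combinatorial lemma *)

(** A continuous image can have larger dimension than its parameter space (space-filling curves), so
    the barycentric coordinates of [f] cannot be counted directly: [g] is made a Lipschitz function
    of them, and counting grid points then replaces dimension theory. The vertex set may be
    infinite, and fibres are controlled only where all coordinates agree exactly; compactness is
    what reduces this to finitely many coordinates agreeing approximately. Fibres are small in l^q
    while the body to be filled is the l^p ball; the norms are compared so that the topology takes
    place in the norm of the ball alone. Composing with the radial retraction extends everything to
    R^n, so that Brouwer's theorem is needed only for maps of R^n into a cube, and the fixed point
    falls into the ball by itself. The exponent comes from t^(1 - p/q) = eps, that is t = eps^(r/p),
    for which t^-p = eps^-r. Constant factors on eps shift the logarithm by a bounded amount, which
    division by |log eps| removes. *)

(** By counting, exactly one fibre of [h] on [A] is a pair and the others are singletons; the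
    removable elements are the two members of that pair. *)
Lemma card_removable (S T : finType) (h : S -> T) (A : {set S}) (B : {set T}) :
  h @: A = B -> #|A| = #|B|.+1 ->
  #|[set a in A | h @: (A :\ a) == B]| = 2.
Proof.
move=> hAB cA.
have inj_rm a : a \in A -> h @: (A :\ a) = B -> {in A :\ a &, injective h}.
  move=> aA ha; apply/imset_injP; rewrite ha.
  by apply/eqP; move: cA; rewrite (cardsD1 a) aA add1n => -[].
have rm_eq a a' : a \in A -> a' \in A -> a != a' -> h a = h a' -> h @: (A :\ a) = B.
  move=> aA a'A aa' haa'; apply/eqP; rewrite eqEsubset -{1}hAB imsetS ?subD1set//=.
  apply/subsetP => b; rewrite -hAB => /imsetP[x xA ->].
  have [->|xa] := eqVneq x a; last by apply: imset_f; rewrite !inE xa.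
  by rewrite haa'; apply: imset_f; rewrite !inE eq_sym aa'.
have [/dinjectiveP hinj|] := boolP (dinjectiveb h A).
  by move: cA; rewrite -hAB card_in_imset// => /eqP; rewrite eqn_leq ltnn andbF.
case/dinjectivePn => a aA [a'].
rewrite !inE => /andP[a'a a'A] haa'.
have ha := rm_eq a a' aA a'A (negbT (etrans (eq_sym _ _) (negbTE a'a))) haa'.
have ha' := rm_eq a' a a'A aA a'a (esym haa').
rewrite (_ : [set _ in A | _] = [set a; a']); last first.
  apply/setP => b; rewrite !inE; apply/andP/orP => [[bA /eqP hb]|]; last first.
    by move=> [/eqP-> | /eqP->]; rewrite ?aA ?a'A ?ha ?ha' eqxx.
  have [_|ba] := eqVneq b a; first by left.
  have [_|ba'] := eqVneq b a'; first by right.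
  have := inj_rm b bA hb a a'; rewrite !inE eq_sym ba eq_sym ba' aA a'A.
  by move=> /(_ isT isT haa') aa'; rewrite aa' eqxx in a'a.
by rewrite cards2 eq_sym (negbTE a'a).
Qed.

Section scarf.
Context (X I : finType) (r : I -> X -> nat).

(** Scarf's notion: no element of [X] exceeds the minimum of [A] in all the orders at once, [r i]
    being the rank in the order [i]. *)
Definition dominating (A : {set X}) :=
  [forall x, exists i, forall a in A, r i x <= r i a].

Lemma dominatingP (A : {set X}) :
  reflect (forall x, exists i, forall a, a \in A -> r i x <= r i a) (dominating A).
Proof.
apply: (iffP forallP) => H x.
  by have /existsP[i /forall_inP] := H x; exists i.
by have [i Hi] := H x; apply/existsP; exists i; apply/forall_inP.
Qed.

Lemma dominatingS (A B : {set X}) : A \subset B -> dominating B -> dominating A.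
Proof.
move=> /subsetP AB /dominatingP dB; apply/dominatingP => x.
by have [i Hi] := dB x; exists i => a /AB; exact: Hi.
Qed.

Hypothesis r_inj : forall i, injective (r i).

(** The candidates for completing [D] when the new element is to be the minimum in the order [i]:
    every other order must keep its minimum in [D]. *)
Definition door_above (D : {set X}) i :=
  [set x | [forall (l | l != i), exists a in D, r l a < r l x]].

Section door.
Variables (D : {set X}) (d0 : X).
Hypotheses (d0D : d0 \in D) (domD : dominating D) (cardD : #|D|.+1 = #|I|).

Let mn i := [arg min_(a < d0 in D) r i a].

Let mnD i : mn i \in D.
Proof. by rewrite /mn; case: arg_minnP. Qed.

Let mn_le i a : a \in D -> r i (mn i) <= r i a.
Proof. by rewrite /mn; case: arg_minnP => // j _ H /H. Qed.

Let mn_eq i a : a \in D -> (forall b, b \in D -> r i a <= r i b) -> mn i = a.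
Proof.
by move=> aD H; apply: (@r_inj i); apply/eqP; rewrite eqn_leq mn_le// H.
Qed.

Let above := door_above D.

Let aboveP i x : reflect (forall l, l != i -> r l (mn l) < r l x) (x \in above i).
Proof.
rewrite inE; apply: (iffP forall_inP) => H l li.
  by have /exists_inP[a aD] := H l li; apply: leq_ltn_trans; exact: mn_le.
by apply/exists_inP; exists (mn l); [exact: mnD | exact: H].
Qed.

(** The orders that [D] can spare: handing one of them over to a new element leaves each element of
    [D] the minimum in some remaining order. *)
Definition door_sides := [set i | mn @: (~: [set i]) == D].

Lemma door_sidesP i a : i \in door_sides -> a \in D ->
  exists2 l, l != i & forall b, b \in D -> r l a <= r l b.
Proof.
rewrite inE => /eqP DE; rewrite -{1}DE => /imsetP[l]; rewrite !inE => li ->.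
by exists l => // b; exact: mn_le.
Qed.

Lemma mem_door_sides i :
  (forall a, a \in D -> exists2 l, l != i & forall b, b \in D -> r l a <= r l b) ->
  i \in door_sides.
Proof.
move=> H; rewrite inE eqEsubset; apply/andP; split.
  by apply/subsetP => _ /imsetP[l _ ->].
apply/subsetP => a aD; have [l li la] := H a aD.
by apply/imsetP; exists l; rewrite ?inE// (mn_eq aD la).
Qed.

(** Domination makes each element of [D] the minimum in some order, so [mn] maps the orders, one
    more than the elements of [D], onto [D]. *)
Lemma card_door_sides : #|door_sides| = 2.
Proof.
have := @card_removable I X mn [set: I] D; rewrite cardsT -cardD.
rewrite (_ : [set _ in _ | _] = door_sides); last first.
  by apply/setP => i; rewrite !inE setTD.
apply => //; apply/eqP; rewrite eqEsubset; apply/andP; split.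
  by apply/subsetP => _ /imsetP[i _ ->].
apply/subsetP => a aD; have [i Hi] := dominatingP _ domD a.
by apply/imsetP; exists i; rewrite ?(mn_eq aD Hi).
Qed.

(* The elements x completing the door D correspond to the two orders that have
   the same minimum on D: x is the best element, for such an order i, among
   those exceeding the minimum of D for all the other orders. *)
Lemma card_rooms_of_door :
  #|[set x | (x \notin D) && dominating (x |: D)]| =
  #|[set i in door_sides | door_above D i != set0]|.
Proof.
set J := [set i in _ | _].
pose top i := [arg max_(x > odflt d0 [pick x in above i] in above i) r i x].
have topP i : i \in J ->
    top i \in above i /\ forall y, y \in above i -> r i y <= r i (top i).
  rewrite inE => /andP[_ /set0Pn[x xM]]; rewrite /top; case: pickP => [y yM|/(_ x)] /=.
    by case: arg_maxnP => // z zM zmax; split.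
  by rewrite xM.
have top_le i a : i \in J -> a \in D -> r i (top i) <= r i a.
  move=> iJ; have [/aboveP tM _] := topP i iJ.
  have [l Hl] := dominatingP _ domD (top i).
  have [li|li] := eqVneq l i; first by rewrite li in Hl; exact: Hl.
  by have := tM l li; rewrite ltnNge Hl.
suff <- : top @: J = [set x | (x \notin D) && dominating (x |: D)].
  rewrite card_in_imset// => i i' iJ i'J tE; apply/eqP/negPn/negP => ii'.
  have [/aboveP/(_ i ii')] := topP i' i'J.
  by rewrite -tE ltnNge top_le.
apply/setP => x; rewrite inE; apply/imsetP/andP => [[i iJ ->]|[xD domx]].
  have [/aboveP tM tmax] := topP i iJ.
  have tD : top i \notin D.
    apply/negP; have := iJ; rewrite !inE => /andP[/eqP<- _] /imsetP[l].
    by rewrite !inE => /tM + tE; rewrite tE ltnn.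
  split=> //; apply/dominatingP => y.
  have [yM|] := boolP (y \in above i).
    by exists i => a; rewrite !inE => /predU1P[->|aD];
      [exact: tmax | apply: leq_trans (top_le i a iJ aD); exact: tmax].
  rewrite inE negb_forall => /existsP[l]; rewrite negb_imply negb_exists.
  move=> /andP[li /forallP/(_ (mn l))]; rewrite mnD -leqNgt => yl.
  exists l => a; rewrite !inE => /predU1P[->|aD]; apply: (leq_trans yl).
    exact/ltnW/tM.
  exact: mn_le.
(* Conversely, take an order [i] in which [x] is below all of [D]. Domination of [x |: D] at each
   [a] in [D] gives [a] an order where it is the minimum and lies below [x]; this order is not [i],
   so [i] is a side of [D]. *)
have [i xi] := dominatingP _ domD x.
have own a : a \in D -> exists l, [/\ l != i, mn l = a & r l a < r l x].
  move=> aD; have [l Hl] := dominatingP _ domx a; exists l.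
  have lax : r l a < r l x.
    rewrite ltn_neqAle Hl ?setU11// andbT; apply: contraNN xD => /eqP/r_inj <- //.
  split => //.
    by apply/eqP => li; move: lax; rewrite li ltnNge xi.
  by apply: mn_eq => // b bD; apply: Hl; rewrite !inE bD orbT.
have iS : mn @: (~: [set i]) = D.
  apply/eqP; rewrite eqEsubset; apply/andP; split.
    by apply/subsetP => _ /imsetP[l _ ->].
  apply/subsetP => a aD; have [l [li <- _]] := own a aD.
  by apply/imset_f; rewrite !inE.
have mninj : {in ~: [set i] &, injective mn}.
  by apply/imset_injP; rewrite iS cardsC1 -cardD.
have xM : x \in above i.
  apply/aboveP => l li; have [l' [l'i /mninj + lx]] := own (mn l) (mnD l).
  by rewrite !inE => ll'; rewrite -{1}[l]ll'// in lx *; rewrite ll' in lx.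
have iJ : i \in J.
  by rewrite !inE iS eqxx; apply/set0Pn; exists x.
exists i => //; apply: (@r_inj i); apply/eqP; have [tM tmax] := topP i iJ.
rewrite eqn_leq tmax//=.
have [l Hl] := dominatingP _ domx (top i).
have [li|li] := eqVneq l i; first by rewrite li in Hl; rewrite Hl// setU11.
by have := aboveP _ _ tM l li; rewrite ltnNge Hl// !inE mnD orbT.
Qed.

End door.


Section completely_labelled.
Context (c : X -> I) (e : I -> X) (x0 : X).
Hypotheses (cardI : 1 < #|I|) (ce : cancel e c).
(* The e i play the role of the facets of a simplex. *)
Hypothesis e_low : forall i x, r i (e i) <= r i x.
Hypothesis e_high : forall i j x, x \notin codom e -> j != i -> r i x < r i (e j).
Hypothesis x0e : x0 \notin codom e.

Let room A := dominating A && (#|A| == #|I|).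

(* Count mod 2 the pairs (A, x) where A is a room and A :\ x carries all the
   labels but i0.  The door D0 made of facets only lies in one room, every other
   such door lies in zero or two; a room that is not completely labelled
   contains zero or two such doors. *)
Lemma exists_completely_labelled :
  exists A : {set X}, [/\ dominating A, #|A| = #|I| & c @: A = setT].
Proof.
have [i0 _] : exists i0 : I, true.
  by have /card_gt0P[i0] := ltnW cardI; exists i0.
have e_inj : injective e by exact: can_inj ce.
pose D0 := e @: (~: [set i0]).
pose door (D : {set X}) := c @: D == ~: [set i0].
pose N := \sum_(A : {set X}) \sum_(x : X | room A && (x \in A) && door (A :\ x)) 1.
have NE : N = \sum_(D : {set X}| door D) \sum_(x | (x \notin D) && room (x |: D)) 1.
  rewrite /N !pair_big_dep/=.
  rewrite (reindex_onto (fun p : {set X} * X => (p.2 |: p.1, p.2))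
    (fun p : {set X} * X => (p.1 :\ p.2, p.2)))/=; last first.
    by move=> [A x] /= /andP[/andP[_ xA] _]; rewrite setD1K.
  apply: eq_bigl => -[D x] /=; rewrite setU11 andbT xpair_eqE eqxx andbT.
  have [xD|xD] := boolP (x \in D).
    rewrite andbF; apply/negbTE; rewrite negb_and orbC.
    suff -> : (x |: D) :\ x != D by [].
    by apply: contraTneq xD => <-; rewrite !inE eqxx.
  by rewrite setU1K// eqxx andbT andbC.
have door_card D : door D -> dominating D -> #|D|.+1 = #|I| -> D != D0 ->
    \sum_(x | (x \notin D) && room (x |: D)) 1 = 2.
  move=> cD dD cardD DD0.
  have /card_gt0P[d0 d0D] : 0 < #|D| by rewrite -ltnS cardD.
  rewrite (eq_bigl (mem [set x | (x \notin D) && dominating (x |: D)])); last first.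
    move=> x; rewrite !inE; case: (boolP (x \in D)) => //= xD.
    by rewrite /room cardsU1 xD add1n cardD eqxx andbT.
  rewrite sum1_card (card_rooms_of_door d0D dD cardD).
  rewrite -[RHS](card_door_sides d0D dD cardD); apply: eq_card => i.
  rewrite [LHS]inE; case: (boolP (i \in _)) => //= iS.
  (* The facet [e i] exceeds the minimum of [D] in every order [l] other than [i], unless [D]
     consists of the facets other than [e l]; the labels of the door then force [l = i0], hence
     [D = D0]. *)
  apply/set0Pn; exists (e i); rewrite inE; apply/forall_inP => l li.
  apply: contraT => /exists_inPn H.
  have {}H a : a \in D -> r l (e i) <= r l a by move=> /H; rewrite -leqNgt.
  have De : D \subset e @: (~: [set l]).
    apply/subsetP => a aD.
    have [/codomP[j aE]|ae] := boolP (a \in codom e); last first.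
      by have := H a aD; rewrite leqNgt e_high// eq_sym.
    rewrite aE; apply: imset_f; rewrite !inE; apply/eqP => jl.
    have := H a aD; rewrite aE jl => ril.
    have /r_inj/e_inj il : r l (e i) = r l (e l) by apply/eqP; rewrite eqn_leq ril e_low.
    by rewrite il eqxx in li.
  have DE : D = e @: (~: [set l]).
    apply/eqP; rewrite eqEcard De card_imset// cardsC1.
    by rewrite -cardD leqnn.
  move: cD DD0; rewrite DE /door -imset_comp (eq_imset _ ce) imset_id => /eqP lE.
  by rewrite /D0 -lE eqxx.
have card_D0 : \sum_(x | (x \notin D0) && room (x |: D0)) 1 = 1.
  have cardD0 : #|D0|.+1 = #|I|.
    by rewrite card_imset// cardsC1 prednK// ltnW.
  have dD0 : dominating D0.
    apply/dominatingP => x.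
    have [/codomP[j ->]|xe] := boolP (x \in codom e); first by exists j => a _; exact: e_low.
    exists i0 => _ /imsetP[j + ->]; rewrite !inE => ji0.
    by apply/ltnW/e_high.
  have /card_gt0P[d0 d0D] : 0 < #|D0| by rewrite -ltnS cardD0.
  rewrite (eq_bigl (mem [set x | (x \notin D0) && dominating (x |: D0)])); last first.
    move=> x; rewrite !inE; case: (boolP (x \in D0)) => //= xD.
    by rewrite /room cardsU1 xD add1n cardD0 eqxx andbT.
  rewrite sum1_card (card_rooms_of_door d0D dD0 cardD0).
  rewrite (_ : [set _ in _ | _] = [set i0]) ?cards1//.
  apply/setP => i; rewrite [LHS]inE [RHS]inE.
  have [->|ii0] := eqVneq i i0.
    apply/andP; split.
      apply: (mem_door_sides d0D) => _ /imsetP[j + ->]; rewrite !inE => ji0.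
      by exists j => // b _; exact: e_low.
    apply/set0Pn; exists x0; rewrite inE; apply/forall_inP => l li0.
    apply/exists_inP; exists (e l); first by apply: imset_f; rewrite !inE.
    rewrite ltn_neqAle e_low andbT; apply: contraNN x0e => /eqP/r_inj <-.
    exact: codom_f.
  (* An element above [D0] for another side [i] exceeds some facet in the order [i0], so it is a
     facet [e k]. It is lowest in the order [k], so [k = i]; but [e i] is already the minimum of
     [D0] in the order [i0]. *)
  apply/negbTE/negP => /andP[iS /set0Pn[x]]; rewrite inE => /forall_inP H.
  have [|l li Hl] := door_sidesP d0D (a := e i) iS.
    by apply: imset_f; rewrite !inE.
  have eD j : j != i0 -> e j \in D0 by move=> ji0; apply: imset_f; rewrite !inE.
  have li0 : l = i0.
    apply/eqP/negPn/negP => /eD/Hl eil; case/eqP: li.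
    by apply/e_inj/esym/(@r_inj l)/eqP; rewrite eqn_leq eil e_low.
  move: (H i0); rewrite eq_sym ii0 => /(_ isT)/exists_inP[a aD ax].
  have /codomP[k xk] : x \in codom e.
    apply/negPn/negP => xe; move: aD ax => /imsetP[j + ->]; rewrite !inE => ji0.
    by rewrite ltnNge ltnW// e_high.
  have [ki|/H] := eqVneq k i; last first.
    by move=> /exists_inP[b _]; rewrite xk ltnNge e_low.
  by move: ax; rewrite ltnNge xk ki -li0 Hl.
have oddN : odd N.
  rewrite NE (bigD1 D0)/=; last first.
    by rewrite /door -imset_comp (eq_imset _ ce) imset_id.
  rewrite card_D0 oddD /= -dvdn2; apply: dvdn_sum => D /andP[doorD DD0].
  have [dD|ndD] := boolP (dominating D && (#|D|.+1 == #|I|)).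
    by case/andP: dD => dD /eqP cD; rewrite door_card.
  rewrite big_pred0// => x; apply/negbTE; apply: contraNN ndD.
  case/andP => xD /andP[dx]; rewrite cardsU1 xD add1n => ->.
  by rewrite (dominatingS _ dx)// subsetUr.
have [/existsP[A /and3P[dA /eqP cA /eqP lA]]|/existsPn noA] :=
  boolP [exists A : {set X}, [&& dominating A, #|A| == #|I| & c @: A == setT]].
  by exists A.
suff : ~~ odd N by rewrite oddN.
rewrite -dvdn2; apply: dvdn_sum => A _.
have [roomA|nroom] := boolP (room A); last by rewrite big_pred0// => x; rewrite (negbTE nroom).
have /andP[dA /eqP cardA] := roomA.
have [/eqP lA|lA] := boolP (c @: A == ~: [set i0]).
  rewrite (eq_bigl (mem [set x in A | c @: (A :\ x) == ~: [set i0]])); last first.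
    by move=> x; rewrite !inE.
  rewrite sum1_card card_removable// cardsC1 prednK ?cardA//.
  exact: ltnW.
rewrite big_pred0// => x; apply/negbTE/negP => /andP[xA /eqP doorAx].
have lAE : c @: A = c x |: ~: [set i0] by rewrite -doorAx -imsetU1 setD1K.
have [cx|cx] := eqVneq (c x) i0.
  by have := noA A; rewrite dA cardA lAE cx setUCr !eqxx.
by case/negP: lA; rewrite lAE; apply/eqP/setUidPr; rewrite sub1set !inE.
Qed.

End completely_labelled.

End scarf.

Lemma sum_option (T : finType) (F : option T -> nat) :
  \sum_i F i = F None + \sum_k F (Some k).
Proof.
rewrite (bigD1 None)//= (reindex_omap Some id) => [|[k|]//].
by congr addn; apply: eq_bigl => k; rewrite /= eqxx.
Qed.

(** * Scarf's lemma on the grid points of a simplex *)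

Section grid.
Variables n m : nat.
Local Notation grid := {ffun 'I_n -> 'I_m.+1}.

Definition in_simplex (z : grid) := \sum_k z k <= m.

(* None stands for the last barycentric coordinate. *)
Definition gcoord (z : grid) (i : option 'I_n) : nat :=
  if i is Some k then z k else m - \sum_k z k.

Lemma sum_gcoord z : in_simplex z -> \sum_i gcoord z i = m.
Proof. by move=> zm; rewrite sum_option/= subnK. Qed.

(** The i-th order compares i-th barycentric coordinates. The grid points of a completely labelled
    dominating set are close together, and a facet in that set forces the corresponding coordinate
    to be small; every label is thus carried by a nearby point or by a nearby facet. *)
Lemma scarf_grid (lab : grid -> option 'I_n) : 0 < n ->
  exists2 z0, in_simplex z0 & forall i, gcoord z0 i <= n \/
    exists z, [/\ in_simplex z, lab z = i &
      forall k, z k <= z0 k + n /\ z0 k <= z k + n].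
Proof.
move=> n_gt0.
pose T := {z : grid | in_simplex z}.
pose I := option 'I_n.
(* Grid points have levels 1 to m + 1, so the facet [j] is below all of them in its own order and
   above all of them in the others. *)
pose level (i : I) (x : T + I) :=
  match x with inl z => (gcoord (val z) i).+1 | inr j => if j == i then 0 else m.+2 end.
(* The factor makes [enum_rank] a mere tie-break between equal levels, turning each level into a
   linear order. *)
pose r i x := level i x * #|{: T + I}| + enum_rank x.
have rP i x y : r i x <= r i y -> level i x <= level i y.
  have yK : enum_rank y < #|{: T + I}| by exact: ltn_ord.
  rewrite /r.
  apply: contraTT; rewrite -!ltnNge => yx.
  have : (level i y).+1 * #|{: T + I}| <= level i x * #|{: T + I}| by rewrite leq_mul2r yx orbT.
  by rewrite mulSn; move: yK; lia.
have ltr i x y : level i x < level i y -> r i x < r i y.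
  by move=> xy; rewrite ltnNge; apply/negP => /rP; rewrite leqNgt xy.
have r_inj i : injective (r i).
  move=> x y; rewrite /r => rxy; apply/enum_rank_inj/val_inj => /=.
  by have := congr1 (modn^~ #|{: T + I}|) rxy; rewrite !modnMDl !modn_small.
pose c (x : T + I) : I := match x with inl z => lab (val z) | inr j => j end.
have zero_in : in_simplex [ffun=> ord0].
  by rewrite /in_simplex big1// => k _; rewrite ffunE.
have gcoord_le z i : in_simplex z -> gcoord z i <= m.
  by move=> /sum_gcoord <-; rewrite (bigD1 i)//= leq_addr.
have [|||||A] := @exists_completely_labelled _ _ r r_inj c inr (inl (Sub _ zero_in)).
- by rewrite card_option card_ord ltnS.
- by [].
- move=> i x; have [->//|xi] := eqVneq x (inr i).
  apply/ltnW/ltr; rewrite /= eqxx; case: x xi => //= j ji.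
  by rewrite ifN//; apply: contraNN ji => /eqP ->.
- move=> i j [z _|k /negP[]]; last by apply: codom_f.
  move=> /negbTE ji; apply: ltr; rewrite /= ji !ltnS; apply: gcoord_le; exact: valP.
- by apply/codomP => -[].
move=> [/dominatingP domA _ cA].
pose C := [set i : I | inr i \notin A].
pose S := [set z : T | inl z \in A].
have ownC i : i \in C -> exists2 s, s \in S & lab (val s) = i.
  rewrite inE => iA; have : i \in c @: A by rewrite cA inE.
  case/imsetP => -[s sA ->|j jA ij]; first by exists s; rewrite ?inE.
  by rewrite ij jA in iA.
have domS (z : T) : exists2 i, i \in C & forall s, s \in S -> gcoord (val z) i <= gcoord (val s) i.
  have [i Hi] := domA (inl z); exists i.
    by rewrite inE; apply/negP => /Hi/rP; rewrite /= eqxx.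
  by move=> s; rewrite inE => /Hi/rP.
have [s0 s0S] : exists s0, s0 \in S.
  have [i iC _] := domS (Sub _ zero_in); have [s sS _] := ownC i iC; by exists s.
pose mi i := gcoord (val [arg min_(s < s0 in S) gcoord (val s) i]) i.
have mi_le i s : s \in S -> mi i <= gcoord (val s) i.
  by rewrite /mi; case: arg_minnP => // ? _ H /H.
have mi_arg i : exists2 s, s \in S & mi i = gcoord (val s) i.
  by rewrite /mi; case: arg_minnP => // s sS _; exists s.
(* Otherwise there is room in the simplex for a grid point whose coordinates in [C] all exceed the
   minima over [S], against domination. *)
have sumC : m < \sum_(i in C) (mi i).+1.
  rewrite ltnNge; apply/negP => Cm.
  pose x : grid := [ffun k => inord (if Some k \in C then (mi (Some k)).+1 else 0)].
  have xE k : x k = (if Some k \in C then (mi (Some k)).+1 else 0) :> nat.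
    rewrite ffunE inordK//; case: ifPn => // kC; rewrite ltnS.
    by apply: leq_trans Cm; rewrite (bigD1 (Some k))//= leq_addr.
  have sumx : \sum_k x k + (if None \in C then (mi None).+1 else 0) =
      \sum_(i in C) (mi i).+1.
    rewrite [RHS]big_mkcond sum_option /= addnC; congr addn.
    by apply: eq_bigr.
  have xin : in_simplex x by rewrite /in_simplex (leq_trans _ Cm)// -sumx leq_addr.
  have [i iC Hi] := domS (Sub x xin).
  have [s sS miE] := mi_arg i.
  have := Hi s sS; rewrite -miE SubK leqNgt; apply/negP/negPn.
  case: i iC {Hi miE} => [k|] iC /=; first by rewrite xE iC.
  by rewrite iC in sumx; rewrite ltn_subRL -addnS sumx.
(* The coordinates of [s] sum to [m], and by [sumC] the minima over [C] sum to more than m - |C|,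
   where |C| is at most n + 1; so at most [n] is left to distribute above them. *)
have slack s : s \in S -> forall i, gcoord (val s) i <= (if i \in C then mi i else 0) + n.
  move=> sS i.
  pose a := \sum_(j | j != i) gcoord (val s) j.
  pose d := \sum_(j | j != i) (if j \in C then mi j else 0).
  have sE : gcoord (val s) i + a = m by apply: etrans (sum_gcoord (valP s)); rewrite [RHS](bigD1 i).
  have Cn : #|C| <= n.+1 by have := max_card (mem C); rewrite card_option card_ord.
  have CE : \sum_(j in C) (mi j).+1 = (if i \in C then mi i else 0) + d + #|C|.
    under eq_bigr do rewrite -addn1.
    by rewrite big_split/= sum1_card big_mkcond (bigD1 i).
  have da : d <= a by apply: leq_sum => j _; case: ifP => // _; exact: mi_le.
  move: sumC; rewrite CE => mC.
  have {}mC := leq_trans mC (leq_add (leqnn _) Cn).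
  move: sE mC da; clearbody a d; case: ifP => _; lia.
exists (val s0); first exact: valP.
move=> i; have [iC|/negbTE iC] := boolP (i \in C); last first.
  by left; have := slack s0 s0S i; rewrite iC.
right; have [s sS ls] := ownC i iC; exists (val s); split => //; first exact: valP.
move=> k; have := slack s sS (Some k); have := slack s0 s0S (Some k).
by have := mi_le (Some k) s sS; have := mi_le (Some k) s0 s0S; case: ifP => _ /=; lia.
Qed.

End grid.

From mathcomp Require Import all_order all_algebra finmap ring lra.
From mathcomp Require Import all_classical all_reals all_analysis.
Import Order.TTheory GRing.Theory Num.Theory.
Import numFieldNormedType.Exports.
Local Open Scope classical_set_scope.
Local Open Scope ring_scope.

(** * Brouwer's fixed point theorem *)

Lemma coord_le_norm (R : realType) n (x : 'rV[R]_n) k : `|x ord0 k| <= `|x|.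
Proof.
rewrite [leRHS]/Num.Def.normr /= mx_normrE.
exact: (le_bigmax _ (fun ij : 'I_1 * 'I_n => `|x ij.1 ij.2|) (ord0, k)).
Qed.

Lemma norm_le_coord (R : realType) n (x : 'rV[R]_n) (e : R) : 0 <= e ->
  (forall k, `|x ord0 k| <= e) -> `|x| <= e.
Proof.
move=> e0 H; rewrite [leLHS]/Num.Def.normr /= mx_normrE.
by apply/bigmax_leP; split => // -[i k] _; rewrite /= (ord1 i).
Qed.

Lemma box_compact (R : realType) n (M : R) :
  compact [set x : 'rV[R]_n | `|x| <= M].
Proof.
apply: bounded_closed_compact.
  by exists M; split => [|y My x /= xM]; [exact: num_real | exact: le_trans xM (ltW My)].
apply: (@closed_comp _ _ (fun x : 'rV[R]_n => `|x|) [set y | y <= M]).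
  by move=> x _; exact: norm_continuous.
exact: closed_le.
Qed.

Section brouwer.
Context (R : realType) (n : nat).
Local Notation N := (n.+1).
Local Notation E := 'rV[R]_N.

(* Barycentric coordinates, up to a constant factor, of the simplex defined by
   x_k >= -1 and \sum_k x_k <= N, which contains the cube [-1, 1]^N. *)
Definition simplex_coord (x : E) (i : option 'I_N) : R :=
  if i is Some k then x ord0 k + 1 else N%:R - \sum_k x ord0 k.

Lemma simplex_coord_lip (x y : E) i : `|simplex_coord x i - simplex_coord y i| <= N%:R * `|x - y|.
Proof.
have xy k : `|x ord0 k - y ord0 k| <= `|x - y|.
  by have := coord_le_norm (x - y) k; rewrite !mxE.
case: i => [k|] /=.
  rewrite [X in `|X|](_ : _ = x ord0 k - y ord0 k); last by ring.
  apply: le_trans (xy k) _.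
  by rewrite ler_peMl// ler1n.
rewrite [X in `|X|](_ : _ = - \sum_k (x ord0 k - y ord0 k)); last first.
  by rewrite sumrB; ring.
rewrite normrN (le_trans (ler_norm_sum _ _ _))//.
apply: (le_trans (ler_sum _ (fun k _ => xy k))).
by rewrite sumr_const card_ord mulr_natl.
Qed.

(** The coordinates of any point sum to 2N, so none can be strictly smaller. *)
Lemma simplex_coord_le_inj (x y : E) : (forall i, simplex_coord x i <= simplex_coord y i) -> x = y.
Proof.
move=> H; have xy k : 0 <= y ord0 k - x ord0 k.
  by have := H (Some k); rewrite /= lerD2r subr_ge0.
have := H None; rewrite /= lerD2l lerN2 -subr_le0 -sumrB => s0.
have /eqP : \sum_k (y ord0 k - x ord0 k) = 0.
  by apply/eqP; rewrite eq_le s0 sumr_ge0.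
rewrite psumr_eq0 => [/allP z|k _]; last exact: xy.
by apply/rowP => k; have := z k (mem_index_enum _); rewrite /= subr_eq0 => /eqP.
Qed.

(** Label a grid point by a coordinate that [F] does not decrease; one exists because the sum of the
    coordinates is constant. As the mesh tends to 0, a cluster point has no coordinate larger than
    that of its image: near a facet this holds because [F] takes its values in the cube, hence in
    the simplex. *)
Theorem brouwer (F : E -> E) : continuous F ->
  (forall x k, `|F x ord0 k| <= 1) -> exists x, F x = x.
Proof.
move=> Fc F1.
have slackF_ge0 x i : 0 <= simplex_coord (F x) i.
  case: i => [k|] /=; first by have := F1 x k; rewrite ler_norml; lra.
  rewrite subr_ge0 -[leRHS](mulr1 N%:R) -[N in leRHS]card_ord mulr_natl -sumr_const.
  by apply: ler_sum => k _; apply: le_trans (ler_norm _) (F1 x k).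
pose pt m (z : {ffun 'I_N -> 'I_m.+2}) : E :=
  \row_k (-1 + 2 * N%:R * (z k)%:R / m.+1%:R).
have slack_pt m (z : {ffun 'I_N -> 'I_m.+2}) i : in_simplex z ->
    simplex_coord (pt m z) i = 2 * N%:R * (gcoord z i)%:R / m.+1%:R.
  move=> zs; case: i => [k|] /=; first by rewrite mxE; ring.
  under eq_bigr do rewrite mxE.
  rewrite big_split/= sumr_const card_ord -mulr_suml -mulr_sumr -natr_sum natrB//.
  by rewrite mulNrn; field; rewrite lt0r_neq0.
pose lab m (z : {ffun 'I_N -> 'I_m.+2}) : option 'I_N :=
  odflt None [pick i | simplex_coord (pt m z) i <= simplex_coord (F (pt m z)) i].
have labP m (z : {ffun 'I_N -> 'I_m.+2}) :
    simplex_coord (pt m z) (lab m z) <= simplex_coord (F (pt m z)) (lab m z).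
  rewrite /lab; case: pickP => //= H; exfalso.
  have {}H i : simplex_coord (F (pt m z)) i < simplex_coord (pt m z) i by rewrite ltNge H.
  have := H None; rewrite /= ltrD2l ltrN2 ltNge => /negP; apply.
  by apply: ler_sum => k _; have := H (Some k); rewrite /= ltrD2r => /ltW.
have near_sol m : exists x : E, `|x| <= 1 + 2 * N%:R /\
    forall i, simplex_coord x i <= 2 * N%:R * N%:R / m.+1%:R \/
      exists y, simplex_coord y i <= simplex_coord (F y) i /\ `|y - x| <= 2 * N%:R * N%:R / m.+1%:R.
  have [//|z0 z0s Hz] := @scarf_grid N m.+1 (lab m).
  exists (pt m z0); split.
    apply: norm_le_coord => [|k]; first by rewrite addr_ge0 ?mulr_ge0.
    rewrite mxE (le_trans (ler_normD _ _))// normrN1 lerD2l.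
    rewrite ger0_norm ?divr_ge0 ?mulr_ge0// ler_pdivrMr ?ltr0n//.
    by rewrite ler_wpM2l ?mulr_ge0// ler_nat -ltnS.
  move=> i; have [zi|[z [zs zi zz]]] := Hz i; [left|right].
    rewrite slack_pt// ler_pM2r ?invr_gt0 ?ltr0n//.
    by rewrite ler_wpM2l ?mulr_ge0// ler_nat.
  exists (pt m z); rewrite -zi; split; first exact: labP.
  apply: norm_le_coord => [|k]; first by rewrite divr_ge0 ?mulr_ge0.
  rewrite !mxE opprD addrACA subrr add0r -mulrBl -mulrBr normrM normrM.
  rewrite (@ger0_norm _ (2 * _)) ?mulr_ge0// (@ger0_norm _ (_^-1)) ?invr_ge0//.
  rewrite ler_pM2r ?invr_gt0 ?ltr0n// ler_wpM2l ?mulr_ge0//.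
  by have [? ?] := zz k; rewrite ler_distl lerBlDr -!natrD !ler_nat; apply/andP; split.
have {near_sol}[x xP] := choice near_sol.
have Dx : (x @ \oo) [set x | `|x| <= 1 + 2 * N%:R].
  by exists 0%N => // m _; have [] := xP m.
have [p [_ clp]] := @box_compact R N (1 + 2 * N%:R) (x @ \oo) _ Dx.
exists p; apply/esym/simplex_coord_le_inj => i.
apply/ler_addgt0Pr => e0 e0_gt0.
(* The budget: at most two Lipschitz estimates of [N%:R * e] each, and one [e] for a coordinate that
   is within the mesh bound of 0. *)
have [e e_gt0 ->] : exists2 e : R, 0 < e & e0 = (2 * N%:R + 1) * e.
  exists (e0 / (2 * N%:R + 1)); first by rewrite divr_gt0// ltr_wpDl ?mulr_ge0.
  by field; rewrite lt0r_neq0// ltr_wpDl ?mulr_ge0.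
have : nbhs p [set y | `|F p - F y| < e].
  by have /cvgrPdist_lt/(_ e e_gt0) := Fc p.
rewrite nbhs_ballP => -[d /= d_gt0 Fd].
pose c := Num.min e d / 2.
have c_gt0 : 0 < c by rewrite divr_gt0// lt_min e_gt0.
have ce : c <= e / 2 by rewrite ler_pM2r// ge_min lexx.
have cd : c <= d / 2 by rewrite ler_pM2r// ge_min lexx orbT.
have [_ [[m /= mc <-] pm]] : [set x m | m in [set m | 2 * N%:R * N%:R / m.+1%:R < c]]
   `&` ball p c !=set0.
  apply: clp; last exact: nbhsx_ballx.
  suff : \forall m \near \oo, 2 * N%:R * N%:R / m.+1%:R < c.
    by apply: filterS => m mc; exists m.
  pose K : R := 2 * N%:R * N%:R.
  have K_gt0 : 0 < K by rewrite !mulr_gt0 ?ltr0n.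
  have cK : 0 < c / K by rewrite divr_gt0.
  near=> m; rewrite -/K mulrC -ltr_pdivlMr//.
  by near: m; exact: (near_infty_natSinv_lt (PosNum cK)).
have {}pm z : `|z - x m| <= 2 * N%:R * N%:R / m.+1%:R -> `|p - z| < Num.min e d.
  move=> zm; have := ler_normD (p - x m) (x m - z); rewrite addrA subrK => /le_lt_trans; apply.
  move: pm; rewrite -ball_normE/= => pm; rewrite (distrC (x m)).
  by have := ltrD pm (le_lt_trans zm mc); rewrite /c -splitr.
have slack_near z : `|p - z| < Num.min e d -> simplex_coord p i <= simplex_coord z i + N%:R * e.
  rewrite lt_min => /andP[pze _]; rewrite -lerBlDl (le_trans (ler_norm _))//.
  by rewrite (le_trans (simplex_coord_lip _ _ _))// ler_wpM2l// ltW.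
have [_ /(_ i)[xi|[y [yi /pm py]]]] := xP m.
  have := slack_near (x m) (pm (x m) _).
  rewrite subrr normr0 divr_ge0 ?mulr_ge0// => /(_ isT) pxm.
  have := slackF_ge0 p i; have : 0 <= N%:R * e by rewrite mulr_ge0// ltW.
  have := le_lt_trans xi mc; move: pxm; rewrite mulrDl -mulrA.
  move: (N%:R * e) => Ne; lra.
have pyi := slack_near y py.
move: py; rewrite lt_min => /andP[_ pyd].
have Fpy : `|F p - F y| < e by apply: Fd; rewrite -ball_normE.
have := simplex_coord_lip (F p) (F y) i; rewrite ler_norml => /andP[Fpyi _].
have : N%:R * `|F p - F y| <= N%:R * e by rewrite ler_wpM2l// ltW.
lra.
Unshelve. all: by end_near.
Qed.

End brouwer.

(** * Maps of small support on the unit ball of a norm *)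

(** Sum over the possible supports: one with at most [k] elements carries at most (M + 1)^k
    functions. *)
Lemma card_small_support (J : finType) (M k : nat) :
  (#|[set u : {ffun J -> 'I_M.+1} | #|[set j | u j != ord0]| <= k]%SET| <=
   2 ^ #|J| * M.+1 ^ k)%N.
Proof.
rewrite -[X in (2 ^ X)%N]cardsT -card_powerset.
rewrite -sum_nat_const.
apply: (@leq_trans (\sum_(T in powerset [set: J])
    \sum_(u : {ffun J -> 'I_M.+1} | [set j | u j != ord0]%SET == T) (#|T| <= k)%N)%N).
  rewrite (exchange_big_dep predT)//= -sum1_card [leqLHS]big_mkcond/=.
  apply: leq_sum => u _; case: ifP => //; rewrite inE => uk.
  rewrite (bigD1 [set j | u j != ord0]%SET)/= ?uk ?addSn//.
  by rewrite powersetE finset.subsetT eqxx.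
apply: leq_sum => T _; case: (leqP #|T| k) => Tk; last by rewrite big1.
rewrite sum1_card; apply: leq_trans (leq_pexp2l _ Tk) => //.
have := @card_pffun_on J 'I_M.+1 ord0 (mem T) predT; rewrite card_ord => <-.
apply/subset_leq_card/fintype.subsetP => u uT'.
have /eqP uT : [set j | u j != ord0]%SET == T := uT'.
apply/pffun_onP; split; last by [].
by apply/fintype.subsetP => j ju; rewrite -uT inE.
Qed.

Section lipschitz_dimension.
Context (R : realType) (X : Type) (J : finType) (N k : nat).
Context (a : X -> J -> R) (g : X -> 'rV[R]_N) (L b : R).
Hypotheses (b_gt0 : 0 < b) (a01 : forall x j, 0 <= a x j <= 1).
Hypothesis a_support : forall x, (#|[set j | a x j != 0%R]%SET| <= k)%N.
Hypothesis g_lip : forall x y e, (forall j, `|a x j - a y j| <= e) ->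
  forall i, `|g x ord0 i - g y ord0 i| <= L * e.
Hypothesis g_surj : forall y : 'rV[R]_N, (forall i, 0 <= y ord0 i <= b) ->
  exists x, g x = y.

(* The (l + 1)^N points of a grid of mesh b / l need distinct codes (the values
   of a rounded to multiples of 1 / M, with M proportional to l), and there are
   at most 2^#|J| (M + 1)^k codes. *)
Lemma lipschitz_image_dim : (N <= k)%N.
Proof.
rewrite leqNgt; apply/negP => kN.
(* Equal codes bound the difference of [a] by 1 / (D l), hence that of [g] by L / (D l), which is
   below the mesh b / l by this choice. *)
pose D := (Num.truncn (`|L| / b)).+1.
have LD : L < D%:R * b.
  rewrite -ltr_pdivrMr// (le_lt_trans _ (truncnS_gt _))//.
  by rewrite ler_pM2r ?invr_gt0// ler_norm.
(* Since M + 1 <= D (l + 1), the number of codes is at most 2^|J| D^k (l + 1)^k = l (l + 1)^k,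
   strictly less than (l + 1)^(k + 1). *)
pose l := (2 ^ #|J| * D ^ k)%N.
have l_gt0 : (0 < l)%N by rewrite muln_gt0 !expn_gt0.
pose M := (D * l)%N.
have M_gt0 : (0 < M)%N by rewrite muln_gt0.
pose key x : {ffun J -> 'I_M.+1} := [ffun j => inord (Num.truncn (M%:R * a x j))].
have Ma_ge0 x j : 0 <= M%:R * a x j by rewrite mulr_ge0//; have /andP[] := a01 x j.
have keyE x j : key x j = Num.truncn (M%:R * a x j) :> nat.
  rewrite ffunE inordK// ltnS truncn_le_nat.
  rewrite (@le_lt_trans _ _ M%:R) ?ltr_nat//.
  by rewrite ler_piMr//; have /andP[] := a01 x j.
have key_eq x y : key x = key y -> forall j, `|a x j - a y j| <= M%:R^-1.
  move=> xy j; rewrite -(ler_pM2l (x := M%:R)) ?ltr0n// mulfV ?pnatr_eq0 -?lt0n//.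
  rewrite -{1}(@ger0_norm _ M%:R)// -normrM mulrBr.
  have := keyE x j; rewrite xy keyE => e.
  have /truncn_itv := Ma_ge0 x j; have /truncn_itv := Ma_ge0 y j; rewrite -e.
  rewrite -natr1 ler_norml; lra.
pose pt (z : {ffun 'I_N -> 'I_l.+1}) : 'rV[R]_N := \row_i (b * (z i)%:R / l%:R).
have pt_in z i : 0 <= pt z ord0 i <= b.
  rewrite mxE divr_ge0 ?mulr_ge0 ?(ltW b_gt0)//= ler_pdivrMr ?ltr0n//.
  by rewrite ler_pM2l// ler_nat -ltnS.
have [s sP] := choice (fun z => g_surj (pt_in z)).
have key_inj : injective (fun z => key (s z)).
  move=> z z' /key_eq H; apply/ffunP => i; apply/val_inj/eqP => /=.
  have := g_lip H i; rewrite !sP !mxE -mulrBl -mulrBr.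
  have -> : L * M%:R^-1 = (L / D%:R) / l%:R.
    by rewrite -mulrA -invfM -natrM.
  rewrite !normrM !(@ger0_norm _ b) ?(ltW b_gt0)//.
  rewrite (@ger0_norm _ (_^-1)) ?invr_ge0// ler_pM2r ?invr_gt0 ?ltr0n//.
  rewrite ler_pdivlMr ?ltr0n// => /le_lt_trans/(_ LD).
  rewrite (_ : b * _ * _ = D%:R * b * `|(z i)%:R - (z' i)%:R|); last by ring.
  rewrite -[ltRHS]mulr1 ltr_pM2l ?mulr_gt0 ?ltr0n//.
  have [zz'|zz'|//] := ssrnat.ltngtP (z i) (z' i).
    rewrite distrC -natrB ?(ltnW zz')// ger0_norm// (ltr_nat _ _ 1) ltnS leqn0.
    by rewrite subn_eq0 leqNgt zz'.
  by rewrite -natrB ?(ltnW zz')// ger0_norm// (ltr_nat _ _ 1) ltnS leqn0 subn_eq0 leqNgt zz'.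
have : (l.+1 ^ N <= 2 ^ #|J| * M.+1 ^ k)%N.
  rewrite -[X in (l.+1 ^ X)%N]card_ord -[X in (X ^ _)%N]card_ord -card_ffun.
  apply: leq_trans (card_small_support J M k); rewrite -(card_imset _ key_inj).
  apply/subset_leq_card/fintype.subsetP => _ /imsetP[z _ ->].
  rewrite inE; apply: leq_trans (a_support (s z)).
  apply/subset_leq_card/fintype.subsetP => j; rewrite !inE; apply: contraNN => /eqP aj0.
  by apply/eqP/val_inj; rewrite /= keyE aj0 mulr0 truncn0.
apply/negP; rewrite -ltnNge.
apply: (@leq_trans (l.+1 ^ k.+1)); last by rewrite leq_pexp2l.
rewrite expnS; apply: (@leq_ltn_trans (l * l.+1 ^ k)); last by rewrite ltn_pmul2r ?expn_gt0.
rewrite -mulnA leq_pmul2l ?expn_gt0// -expnMn.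
by case: (k) => [|k']//; rewrite leq_exp2r// mulnS /M; lia.
Qed.

End lipschitz_dimension.

Lemma ler_dist_prod (R : realDomainType) (J : finType) (s t : J -> R) :
  (forall j, 0 <= s j <= 1) -> (forall j, 0 <= t j <= 1) ->
  `|\prod_j s j - \prod_j t j| <= \sum_j `|s j - t j|.
Proof.
move=> s01 t01.
suff : [/\ `|\prod_j s j - \prod_j t j| <= \sum_j `|s j - t j|,
   0 <= \prod_j s j <= 1 & 0 <= \prod_j t j <= 1] by case.
elim/big_rec3: _ => [|j d y x _ [xyd /andP[x0 x1] /andP[y0 y1]]].
  by split; rewrite ?subrr ?normr0 ?lexx ?ler01.
have /andP[s0 s1] := s01 j; have /andP[t0 t1] := t01 j.
split; [|by rewrite mulr_ge0//= mulr_ile1..].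
rewrite (_ : _ - _ = (s j - t j) * x + t j * (x - y)); last by ring.
rewrite (le_trans (ler_normD _ _))// !normrM lerD//.
  by rewrite ler_piMr// ger0_norm.
by rewrite (le_trans _ xyd)// ler_piMl// ger0_norm.
Qed.

Section tent.
Context (R : realType).
Implicit Types s t z : R.

Definition clamp z : R := Num.min 1 (Num.max 0 z).

Lemma clamp_mono : {homo clamp : s t / s <= t}.
Proof.
move=> s t st; rewrite /clamp le_min !ge_min lexx /=.
by rewrite ge_max !le_max lexx st !orbT.
Qed.

Lemma clamp_ge0 z : 0 <= clamp z.
Proof. by rewrite /clamp le_min ler01 le_max lexx. Qed.

Lemma clamp_le1 z : clamp z <= 1.
Proof. by rewrite /clamp ge_min lexx. Qed.

Lemma clamp0 z : z <= 0 -> clamp z = 0.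
Proof. by move=> z0; rewrite /clamp max_l// min_r. Qed.

Lemma clamp1 z : 1 <= z -> clamp z = 1.
Proof.
by move=> z1; rewrite /clamp max_r ?(le_trans ler01)// min_l.
Qed.

Lemma clamp_id z : 0 <= z <= 1 -> clamp z = z.
Proof. by move=> /andP[z0 z1]; rewrite /clamp max_r// min_r. Qed.

Lemma clamp_lip s t : `|clamp s - clamp t| <= `|s - t|.
Proof.
wlog st : s t / s <= t.
  by move=> H; have [|/ltW] := leP s t; [exact: H | move=> /H; rewrite distrC (distrC t)].
rewrite distrC (distrC s) !ger0_norm ?subr_ge0 ?clamp_mono//.
have [s0|s0] := leP s 0.
  rewrite (clamp0 s0).
  have [t0|t0] := leP t 0; first by rewrite clamp0//; lra.
  have [t1|t1] := leP 1 t; first by rewrite clamp1//; lra.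
  by rewrite clamp_id; lra.
have [s1|s1] := leP 1 s; first by rewrite !clamp1//; lra.
rewrite (@clamp_id s); last by lra.
have [t1|t1] := leP 1 t; first by rewrite clamp1//; lra.
by rewrite clamp_id; lra.
Qed.

(* The hat function of the node i, written as a difference so that the hat
   functions of consecutive nodes telescope to a partition of unity. *)
Definition tent (i : nat) s : R := clamp (s - i%:R + 1) - clamp (s - i%:R).

Lemma tent_ge0 i s : 0 <= tent i s.
Proof. by rewrite subr_ge0 clamp_mono// lerDl. Qed.

Lemma tent_le1 i s : tent i s <= 1.
Proof. by rewrite lerBlDr -[leLHS]addr0 lerD ?clamp_le1 ?clamp_ge0. Qed.

Lemma tent_lip i s t : `|tent i s - tent i t| <= 2 * `|s - t|.
Proof.
rewrite (_ : tent i s - tent i t = (clamp (s - i%:R + 1) - clamp (t - i%:R + 1)) -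
  (clamp (s - i%:R) - clamp (t - i%:R))); last by rewrite /tent; ring.
rewrite (le_trans (ler_normB _ _))// mulr_natl mulr2n lerD//.
  by rewrite (le_trans (clamp_lip _ _))//; have -> : s - i%:R + 1 - (t - i%:R + 1) = s - t by ring.
by rewrite (le_trans (clamp_lip _ _))//; have -> : s - i%:R - (t - i%:R) = s - t by ring.
Qed.

Lemma tent_neq0 i s : tent i s != 0 -> `|s - i%:R| < 1.
Proof.
apply: contraNT; rewrite -leNgt ler_normr /tent => /orP[H|H].
  by rewrite !clamp1 ?subrr//; lra.
by rewrite !clamp0 ?subrr//; lra.
Qed.

Lemma sum_tent m s : 0 <= s <= m%:R -> \sum_(i < m.+1) tent i s = 1.
Proof.
move=> /andP[s0 sm]; rewrite -(big_mkord xpredT (tent ^~ s)).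
rewrite (eq_bigr (fun i => - (clamp (s + 1 - i.+1%:R) - clamp (s + 1 - i%:R)))); last first.
  by move=> i _; rewrite /tent opprB -natr1; congr (clamp _ - clamp _); ring.
rewrite sumrN telescope_sumr// clamp0; last by rewrite -natr1; lra.
by rewrite sub0r opprK clamp1//; lra.
Qed.

End tent.

(* Without this join, [compact_cover] does not apply to product types. *)
HB.instance Definition _ (U W : ptopologicalType) := Pointed.on (U * W)%type.

Lemma continuous_dist (R : realType) (U W : normedModType R) (f : U -> W) :
  continuous f <-> forall x e, 0 < e ->
    exists2 d, 0 < d & forall y, `|x - y| < d -> `|f x - f y| < e.
Proof.
split=> [fc x e e0|H x].
  have /cvgrPdist_lt/(_ e e0) := fc x; move=> /nbhs_ballP[d /= d0 fd].
  by exists d => // y xy; apply: fd; rewrite -ball_normE.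
apply/cvgrPdist_lt => e /(H x)[d d0 fd]; apply/nbhs_ballP.
by exists d => // y; rewrite -ball_normE => /fd.
Qed.

Section norm_ball.
Context (R : realType) (n : nat).
Local Notation N := (n.+1).
Local Notation E := 'rV[R]_N.
Context (nu : E -> R) (C : R).
Hypothesis nuD : forall x y, nu (x + y) <= nu x + nu y.
Hypothesis nuZ : forall w x, nu (w *: x) = `|w| * nu x.
Hypothesis nu_ge : forall x, `|x| <= nu x.
Hypothesis nu_le : forall x, nu x <= C * `|x|.
Hypothesis C_gt0 : 0 < C.

Let nu_ge0 x : 0 <= nu x.
Proof. exact: le_trans (nu_ge x). Qed.

Let nu0 : nu 0 = 0.
Proof. by rewrite -(scale0r 0) nuZ normr0 mul0r. Qed.

Let nuN x : nu (- x) = nu x.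
Proof. by rewrite -scaleN1r nuZ normrN1 mul1r. Qed.

Let nu_sum (I : finType) (F : I -> E) : nu (\sum_i F i) <= \sum_i nu (F i).
Proof.
elim/big_ind2: _ => [|x a y b xa yb|//]; first by rewrite nu0.
exact: le_trans (nuD _ _) (lerD xa yb).
Qed.

Lemma seminorm_continuous : continuous nu.
Proof.
apply/(@continuous_dist R E R^o) => x e e_gt0.
exists (e / C) => [|y]; first by rewrite divr_gt0.
rewrite ltr_pdivlMr// mulrC => /(le_lt_trans (nu_le _)) xy.
apply: le_lt_trans xy.
have h1 := nuD (x - y) y; have h2 := nuD (y - x) x; rewrite !subrK in h1 h2.
have h3 : nu (y - x) = nu (x - y) by rewrite -opprB nuN.
rewrite ler_norml; lra.
Qed.

Definition retract (x : E) : E := (Num.max 1 (nu x))^-1 *: x.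

Lemma nu_retract x : nu (retract x) <= 1.
Proof.
have m_gt0 : 0 < Num.max 1 (nu x) by rewrite lt_max ltr01.
rewrite nuZ ger0_norm ?invr_ge0 ?(ltW m_gt0)// mulrC ler_pdivrMr// mul1r.
by rewrite le_max lexx orbT.
Qed.

Lemma retract_id x : nu x <= 1 -> retract x = x.
Proof. by move=> x1; rewrite /retract max_l// invr1 scale1r. Qed.

Lemma retract_continuous : continuous retract.
Proof.
move=> x; apply: (@cvgZ R E E (nbhs x) _ (fun y => (Num.max 1 (nu y))^-1) id); last exact: cvg_id.
apply: cvgV; first by rewrite gt_eqF// lt_max ltr01.
apply: (@continuous_max R E (cst 1) nu x); last exact: seminorm_continuous.
exact: cst_continuous.
Qed.

Section low_dimensional_maps.
Context (V : choiceType) (u : E -> V -> R) (k : nat) (d : R).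
Hypothesis u_continuous : forall v, continuous (u ^~ v).
Hypothesis u01 : forall x v, 0 <= u x v <= 1.
Hypothesis u_support : forall x, exists2 s : {fset V},
  (#|` s| <= k)%N & forall v, v \notin s -> u x v = 0.
Hypothesis d_lt1 : d < 1.
Hypothesis u_fibre : forall x y, nu x <= 1 -> nu y <= 1 ->
  (forall v, u x v = u y v) -> nu (x - y) <= d.

(** Halfway between [d] and 1: the gap above [d] serves the compactness argument, the gap below 1
    leaves room for Brouwer's theorem. *)
Let d1 := (1 + d) / 2.

(** The pairs of points of the ball at distance at least [d1] form a compact set, and by [u_fibre]
    each of them is strictly separated by some coordinate; a finite subcover yields [F] and
    [eta]. *)
Lemma finite_separation : exists (F : {fset V}) (eta : R), 0 < eta /\
  forall x y, nu x <= 1 -> nu y <= 1 ->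
    (forall v, v \in F -> `|u x v - u y v| < eta) -> nu (x - y) < d1.
Proof.
have dd1 : d < d1 by rewrite ltr_pdivlMr//; move: d_lt1; lra.
pose B := [set x : E | nu x <= 1].
have Bcl (T : topologicalType) (h : T -> R) : continuous h -> closed [set x | h x <= 1].
  move=> hc; apply: (@closed_comp _ _ h [set y | y <= 1]); last exact: closed_le.
  by move=> x _; exact: hc.
have B_compact : compact B.
  apply: (@subclosed_compact _ _ [set x | `|x| <= 1]).
  - exact: Bcl seminorm_continuous.
  - exact: box_compact.
  - by move=> x /=; exact: le_trans (nu_ge x).
pose K := (B `*` B) `&` [set z : E * E | d1 <= nu (z.1 - z.2)].
have K_compact : compact K.
  apply: compact_closedI; first exact: compact_setX.
  apply: (@closed_comp _ _ (fun z : E * E => nu (z.1 - z.2)) [set y | d1 <= y]);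
    last exact: closed_ge.
  move=> z _; apply: continuous_comp; last exact: seminorm_continuous.
  by apply: cvgB; [exact: cvg_fst|exact: cvg_snd].
pose U (i : V * nat) := [set z : E * E | i.2.+1%:R^-1 < `|u z.1 i.1 - u z.2 i.1|].
have U_open i : open (U i).
  apply: (@open_comp _ _ (fun z : E * E => `|u z.1 i.1 - u z.2 i.1|)
    [set y | i.2.+1%:R^-1 < y]); last exact: open_gt.
  move=> z _; apply: cvg_norm; apply: cvgB.
    apply: (@continuous_comp _ _ _ fst (u ^~ i.1)); last exact: u_continuous.
    exact: cvg_fst.
  apply: (@continuous_comp _ _ _ snd (u ^~ i.1)); last exact: u_continuous.
  exact: cvg_snd.
have KU : K `<=` cover setT U.
  move=> z [[z1 z2] /= zd].
  have [v zv] : exists v, u z.1 v != u z.2 v.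
    apply: contrapT => /forallNP H; move: zd; apply/negP; rewrite -ltNge (le_lt_trans _ dd1)//.
    by apply: u_fibre => // v; apply/eqP/negPn/negP/H.
  have uz : 0 < `|u z.1 v - u z.2 v| by rewrite normr_gt0 subr_eq0.
  have [m _ Hm] := near_infty_natSinv_lt (PosNum uz).
  by exists (v, m) => //; apply: Hm => /=.
have K_cover : cover_compact K.
  by move: K_compact; rewrite -(@compact_cover ((E * E)%type : ptopologicalType)).
have [D _ KD] := K_cover _ _ _ (fun i _ => U_open i) KU.
pose M := \max_(i <- D) i.2.
exists [fset i.1 | i in D]%fset, M.+1%:R^-1; split; first by rewrite invr_gt0.
move=> x y x1 y1 xy; rewrite ltNge; apply/negP => dxy.
have [i /= iD] := KD (x, y) (conj (conj x1 y1) dxy).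
rewrite /U /= => H; have := xy i.1 (in_imfset _ _ iD).
apply/negP; rewrite -leNgt (le_trans _ (ltW H))// lef_pV2 ?posrE ?ltr0n// ler_nat ltnS.
by rewrite /M (big_rem i)//= leq_maxl.
Qed.

Theorem norm_ball_dim : (N <= k)%N.
Proof.
have d1_lt1 : d1 < 1 by rewrite /d1; move: d_lt1; lra.
have [F [eta [eta_gt0 Feta]]] := finite_separation.
pose a (x : E) (j : F) := u (retract x) (val j).
(* Two points where the same product of hat functions is nonzero have coordinates less than 2 / (m +
   1) apart, so [Feta] applies to them. *)
pose m := Num.truncn (2 / eta).
have m_gt : 2 / m.+1%:R < eta.
  rewrite ltr_pdivrMr ?ltr0n// mulrC -ltr_pdivrMr//.
  exact: truncnS_gt.
pose s x j : R := m.+1%:R * a x j.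
pose tau (c : {ffun F -> 'I_m.+2}) x := \prod_j tent (c j) (s x j).
have tent01 i (z : R) : 0 <= tent i z <= 1 by rewrite tent_ge0 tent_le1.
have tau_ge0 c x : 0 <= tau c x by apply: prodr_ge0 => j _; exact: tent_ge0.
have sum_tau x : \sum_c tau c x = 1.
  rewrite -(bigA_distr_bigA (fun j (i : 'I_m.+2) => tent i (s x j))) big1// => j _.
  by rewrite sum_tent// mulr_ge0//= ?ler_piMr//; have /andP[] := u01 (retract x) (val j).
have tau_near c x : tau c x != 0 -> forall j, `|s x j - (c j)%:R| < 1.
  by move=> /prodf_neq0 H j; apply: tent_neq0; exact: H.
have centre c : exists z, nu z <= 1 /\
    forall x, nu x <= 1 -> tau c x != 0 -> nu (x - z) < d1.
  have [[z z1 zc]|noz] := pselect (exists2 z, nu z <= 1 & forall j, `|s z j - (c j)%:R| < 1).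
    exists z; split => // x x1 /tau_near xc; apply: Feta => // v vF.
    have := xc [` vF]%fset; have := zc [` vF]%fset; rewrite /s /a /= !retract_id//.
    move=> zv xv; apply: lt_trans m_gt; rewrite ltr_pdivlMr ?ltr0n//.
    rewrite -{1}(@ger0_norm _ m.+1%:R)// -normrM mulrBl ![_ * m.+1%:R]mulrC.
    move: zv xv; rewrite !ltr_norml; lra.
  (* No point of the ball lies in this cell, so [tau c] vanishes on the ball and any centre of norm
     at most 1 will do. *)
  exists 0; split; first by rewrite nu0.
  by move=> x x1 /tau_near xc; exfalso; apply: noz; exists x.
have {centre}[z zP] := choice centre.
have z1 c : nu (z c) <= 1 by have [] := zP c.
have {}zP c := proj2 (zP c).
pose g x := \sum_c tau c x *: z c.
have g_near x : nu x <= 1 -> nu (x - g x) <= d1.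
  move=> x1.
  have -> : x - g x = \sum_c tau c x *: (x - z c).
    under [RHS]eq_bigr do rewrite scalerBr.
    by rewrite sumrB -scaler_suml sum_tau scale1r.
  apply: (le_trans (nu_sum _)).
  rewrite -[leRHS]mul1r -(sum_tau x) mulr_suml; apply: ler_sum => c _.
  rewrite nuZ ger0_norm//.
  have [->|tc] := eqVneq (tau c x) 0; first by rewrite !mul0r.
  by rewrite ler_wpM2l// ltW// zP.
(* Number of cells, times number of factors in each product, times the Lipschitz constant of a hat
   function after scaling by m + 1. *)
pose L : R := #|{ffun F -> 'I_m.+2}|%:R * (#|{: F}|%:R * (2 * m.+1%:R)).
have g_lip x y e : (forall j, `|a x j - a y j| <= e) ->
    forall i, `|g x ord0 i - g y ord0 i| <= L * e.
  move=> xy i; rewrite /g !summxE -sumrB (le_trans (ler_norm_sum _ _ _))//.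
  rewrite /L -mulrA mulr_natl -sumr_const; apply: ler_sum => c _.
  rewrite !mxE -mulrBl normrM.
  have zci : `|z c ord0 i| <= 1.
    by apply: le_trans (coord_le_norm _ _) (le_trans (nu_ge _) (z1 c)).
  rewrite (le_trans (ler_piMr _ zci))// (le_trans (ler_dist_prod _ _))//.
  rewrite -mulrA mulr_natl -sumr_const; apply: ler_sum => j _.
  rewrite (le_trans (tent_lip _ _ _))// -mulrA ler_wpM2l//.
  by rewrite /s -mulrBr normrM ger0_norm// ler_wpM2l.
have L_ge0 : 0 <= L by rewrite !mulr_ge0.
have a_continuous j : continuous (a ^~ j).
  move=> x; apply: (@continuous_comp _ _ _ retract (u ^~ (val j))).
    exact: retract_continuous.
  exact: u_continuous.
have g_continuous : continuous g.
  apply/continuous_dist => x e e_gt0.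
  pose e1 := e / (L + 1) / 2.
  have e1_gt0 : 0 < e1 by rewrite !divr_gt0// ltr_wpDl.
  have Le1 : L * e1 < e.
    have : (L + 1) * e1 = e / 2 by rewrite /e1; field; rewrite gt_eqF// ltr_wpDl.
    by move: e_gt0 e1_gt0; nra.
  have : nbhs x [set y | forall j, `|a x j - a y j| < e1].
    apply: (@filter_forall _ F (fun j y => `|a x j - a y j| < e1) (nbhs x)) => j.
    by have /cvgrPdist_lt := a_continuous j x; exact.
  rewrite nbhs_ballP => -[r /= r_gt0 xr]; exists r => // y xy.
  apply: le_lt_trans Le1; apply: norm_le_coord; first by rewrite mulr_ge0// ltW.
  move=> i; rewrite !mxE; apply: g_lip => j; apply/ltW/xr.
  by rewrite -ball_normE.
(* A cube of this side lies in the [nu]-ball of radius 1 - d1, the room left by [g_near]. *)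
apply: (@lipschitz_image_dim R E F N k a g L ((1 - d1) / C)) => //.
- by rewrite divr_gt0// subr_gt0.
- by move=> x j; exact: u01.
- move=> x; have [t tk tP] := u_support (retract x).
  apply: leq_trans tk; rewrite cardE -(size_map val).
  apply: uniq_leq_size.
    by rewrite map_inj_uniq ?enum_uniq//; exact: val_inj.
  move=> v /mapP[j]; rewrite mem_enum inE => aj ->.
  by apply: contraNT aj => /tP; rewrite /a => ->.
- move=> y yb.
  have y1 : nu y <= 1 - d1.
    apply: (le_trans (nu_le y)); rewrite mulrC -ler_pdivlMr//.
    apply: norm_le_coord => [|i]; first by rewrite divr_ge0 ?ltW// subr_gt0.
    by have /andP[yi0 yi] := yb i; rewrite ger0_norm.
  (* This map takes values of norm at most d1 + (1 - d1) = 1, so its fixed point is in the ball,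
     where the retraction is the identity and the equation reduces to [g x = y]. *)
  have [||x xE] := @brouwer R n (fun x => retract x - g (retract x) + y).
  + move=> x; apply: (@cvgD _ _ _ (nbhs x) _ (fun x => retract x - g (retract x)) (cst y));
      last exact: cvg_cst.
    apply: cvgB; first exact: retract_continuous.
    by apply: continuous_comp; [exact: retract_continuous | exact: g_continuous].
  + move=> x i; apply: le_trans (coord_le_norm _ _) (le_trans (nu_ge _) _).
    rewrite (le_trans (nuD _ _))//.
    have := g_near _ (nu_retract x); move: y1; lra.
  exists x; have x1 : nu x <= 1.
    rewrite -xE (le_trans (nuD _ _))//.
    have := g_near _ (nu_retract x); move: y1; lra.
  move: xE; rewrite retract_id// => /(congr1 (fun w => w - x)).
  by rewrite addrAC (addrAC x) !subrr add0r addrC => /eqP; rewrite subr_eq0 eq_sym => /eqP.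
Qed.

End low_dimensional_maps.
End norm_ball.

(** * Lower bound for the width dimension *)

Section polyhedra.
Context (R : realType) (V : choiceType) (K : simplicial_complex V).

Lemma bary_inj (x y : polyhedron R V K) : (forall v, x v = y v) -> x = y.
Proof.
case: x y => [f f0 fs] [g g0 gs] /= /funext fg; subst g.
by rewrite (Prop_irrelevance f0 g0) (Prop_irrelevance fs gs).
Qed.

Lemma bary_le1 (x : polyhedron R V K) v : x v <= 1.
Proof.
have [s Ks [xs <-]] := bary_simplex x.
have [vs|/xs ->] := boolP (v \in s); last by apply: sumr_ge0 => w _; exact: bary_ge0.
rewrite (big_rem v)//= lerDl; apply: sumr_ge0 => w _; exact: bary_ge0.
Qed.

Lemma bary_continuous v : continuous (fun x : polyhedron R V K => x v).
Proof.
move=> x; apply/(@cvgrPdist_lt R R^o (polyhedron R V K) (nbhs x) (nbhs_filter x)) => e e_gt0.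
pose U := [set y : polyhedron R V K | `|x v - y v| < e].
have oU : open U.
  move=> s Ks y ys Uy; exists (e - `|x v - y v|); first by rewrite subr_gt0.
  move=> z zs yz; rewrite /U /=; have [vs|vs] := boolP (v \in s).
    by have := ler_distD (y v) (x v) (z v); have := yz v vs; lra.
  by rewrite (zs v vs) -(ys v vs).
by apply: open_nbhs_nbhs; split => //=; rewrite /U /= subrr normr0.
Qed.

End polyhedra.

(** * Comparison of the l^p and l^q distances *)

Section norms.
Context (R : realType).

Lemma lq_dist_sub q n (x y : 'rV[R]_n) : lq_dist q x y = lq_dist q (x - y) 0.
Proof.
have E k : x ord0 k - y ord0 k = (x - y) ord0 k - (0 : 'rV[R]_n) ord0 k.
  by rewrite !mxE subr0.
case: q => [q| |]; last by [].
  by rewrite /lq_dist; under eq_bigr do rewrite E.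
by rewrite /lq_dist; under eq_bigr do rewrite E.
Qed.

Lemma powR_norm_root (p z : R) : 1 <= p -> (`|z| `^ p) `^ p^-1 = `|z|.
Proof. by move=> p1; rewrite -powRrM mulfV ?powRr1// gt_eqF// (lt_le_trans ltr01). Qed.

Lemma coord_le_lq_dist q n (x y : 'rV[R]_n) k : (1 <= q)%E ->
  `|x ord0 k - y ord0 k| <= lq_dist q x y.
Proof.
case: q => [q| |]//= q1; last exact: (le_bigmax _ (fun k => `|x ord0 k - y ord0 k|)).
rewrite -[leLHS](powR_norm_root _ q1) ge0_ler_powR ?invr_ge0 ?nnegrE ?powR_ge0//.
- by rewrite (le_trans ler01).
- by apply: sumr_ge0 => *; exact: powR_ge0.
- by rewrite (bigD1 k)//= lerDl sumr_ge0// => *; exact: powR_ge0.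
Qed.

Lemma lq_dist_le_coord q n (x y : 'rV[R]_n.+1) : (1 <= q)%E ->
  lq_dist q x y <= n.+1%:R * `|x - y|.
Proof.
have xy k : `|x ord0 k - y ord0 k| <= `|x - y|.
  by have := coord_le_norm (x - y) k; rewrite !mxE.
have := normr_ge0 (x - y); move: (`|x - y|) xy => M xy M0.
have n1 : 1 <= n.+1%:R :> R by rewrite ler1n.
case: q => [q| |]//= q1; last first.
  by apply/bigmax_leP; split => [|k _]; rewrite ?mulr_ge0// (le_trans (xy k))// ler_peMl.
have q_gt0 : 0 < q by rewrite (lt_le_trans ltr01).
have -> : n.+1%:R * M = ((n.+1%:R * M) `^ q) `^ q^-1.
  by rewrite -[in RHS](@ger0_norm _ (_ * _)) ?mulr_ge0// powR_norm_root// ger0_norm ?mulr_ge0.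
rewrite ge0_ler_powR ?invr_ge0 ?nnegrE ?powR_ge0 ?(ltW q_gt0)//.
  by apply: sumr_ge0 => *; exact: powR_ge0.
apply: (@le_trans _ _ (n.+1%:R * M `^ q)).
  rewrite mulr_natl -[n.+1 in leRHS]card_ord -sumr_const.
  by apply: ler_sum => k _; rewrite ge0_ler_powR ?nnegrE ?(ltW q_gt0).
by rewrite powRM// ler_wpM2r ?powR_ge0// le1r_powR.
Qed.

Lemma lp_distZ (p w : R) n (x : 'rV[R]_n) : 1 <= p ->
  lq_dist p%:E (w *: x) 0 = `|w| * lq_dist p%:E x 0.
Proof.
move=> p1; rewrite /lq_dist.
have E k : `|(w *: x) ord0 k - (0 : 'rV[R]_n) ord0 k| `^ p =
    `|w| `^ p * `|x ord0 k - (0 : 'rV[R]_n) ord0 k| `^ p.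
  by rewrite !mxE !subr0 normrM powRM.
rewrite (eq_bigr _ (fun k _ => E k)) -mulr_sumr powRM ?powR_ge0//.
  by rewrite powR_norm_root.
by apply: sumr_ge0 => *; exact: powR_ge0.
Qed.

Lemma lp_dist_le (p c : R) n (x y : 'rV[R]_n) : 0 < p -> 0 <= c ->
  (lq_dist p%:E x y <= c) = (\sum_k `|x ord0 k - y ord0 k| `^ p <= c `^ p).
Proof.
move=> p0 c0 /=; have S0 : 0 <= \sum_k `|x ord0 k - y ord0 k| `^ p.
  by apply: sumr_ge0 => *; exact: powR_ge0.
apply/idP/idP => H.
  rewrite -[leLHS]powRr1// -(mulVf (lt0r_neq0 p0)) powRrM.
  by rewrite ge0_ler_powR ?nnegrE ?powR_ge0 ?(ltW p0).
rewrite -[leRHS]powRr1// -(mulfV (lt0r_neq0 p0)) powRrM.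
by rewrite ge0_ler_powR ?nnegrE ?powR_ge0 ?invr_ge0 ?(ltW p0).
Qed.

Section exponents.
Context (p : R) (q : \bar R) (p1 : 1 <= p) (pq : (p%:E < q)%E).
Local Notation r := (growth_exponent p q).

Let p_gt0 : 0 < p. Proof. exact: lt_le_trans p1. Qed.

Lemma growth_exponent_gt0 : 0 < r.
Proof.
case: q pq => [q0| |]//=; rewrite lte_fin => pq0.
by rewrite divr_gt0 ?mulr_gt0 ?subr_gt0// (lt_trans p_gt0).
Qed.

(** For finite q and t = e^(r/p), the bound |z_k|^q <= t^(q - p) |x_k|^p sums to at most t^(q - p),
    which is e^q because r (q - p) / p = q. For infinite q, r / p = 1. *)
Lemma truncation_lq_dist (e : R) n (x z : 'rV[R]_n) : 0 < e ->
  \sum_k `|x ord0 k| `^ p <= 1 ->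
  (forall k, `|z ord0 k| <= `|x ord0 k| /\ `|z ord0 k| <= e `^ (r / p)) ->
  lq_dist q z 0 <= e.
Proof.
move=> e0 x1 zx; case: q pq zx => [q0| |]//=; last first.
  move=> _ zx; apply/bigmax_leP; split => [|k _]; first exact: ltW.
  by have [_] := zx k; rewrite divff ?gt_eqF// powRr1 ?(ltW e0)// mxE subr0.
rewrite lte_fin => pq0 zx; have q_gt0 := lt_trans p_gt0 pq0.
rewrite -[_ `^ _]/(lq_dist q0%:E z 0) lp_dist_le ?(ltW e0)//.
set t := e `^ _ in zx.
have tE : t `^ (q0 - p) = e `^ q0.
  by rewrite -powRrM; congr powR; field; rewrite !gt_eqF ?subr_gt0.
rewrite -tE -[leRHS]mulr1; apply: le_trans (ler_wpM2l (powR_ge0 _ _) x1).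
rewrite mulr_sumr; apply: ler_sum => k _; rewrite mxE subr0; have [zx1 zt] := zx k.
have -> : `|z ord0 k| `^ q0 = `|z ord0 k| `^ (q0 - p) * `|z ord0 k| `^ p.
  by rewrite -powRD ?subrK// gt_eqF.
by rewrite ler_pM ?powR_ge0// ge0_ler_powR ?nnegrE ?powR_ge0// ltW ?subr_gt0.
Qed.

(** The conclusion supplies the constant [d] of the norm-ball argument: the p-th powers sum to at
    most 1/2, and the p-th root of 1/2 is below 1. The factor 4 on [e] is there because 4^-q <=
    1/4. *)
Lemma lq_dist_lp_dist (e : R) n (x y : 'rV[R]_n) : 0 < e ->
  n%:R * (4 * e) `^ r <= 4^-1 -> lq_dist q x y <= e ->
  lq_dist p%:E x y <= (2^-1) `^ p^-1.
Proof.
move=> e0 ne xy; rewrite lp_dist_le ?powR_ge0//.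
rewrite -powRrM mulVf ?gt_eqF// powRr1 ?invr_ge0//.
have e4 : 0 < 4 * e by rewrite mulr_gt0.
case: q pq ne xy => [q0| |] //.
  rewrite lte_fin => pq0 ne xy; have q_gt0 := lt_trans p_gt0 pq0.
  move: xy; rewrite lp_dist_le ?(ltW e0)// => xy.
  (* |z|^p <= t^p if |z| <= t, and |z|^p <= t^(p - q) |z|^q otherwise; both
     contributions to the sum are at most 1/4 for this t. *)
  pose t := (4 * e) `^ (growth_exponent p q0%:E / p).
  have t_gt0 : 0 < t by rewrite powR_gt0.
  have tp : t `^ p = (4 * e) `^ growth_exponent p q0%:E.
    by rewrite -powRrM divfK// gt_eqF.
  have tpq : t `^ (p - q0) = (4 * e) `^ (- q0).
    by rewrite -powRrM /=; congr powR; field; rewrite !gt_eqF ?subr_gt0.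
  have bound (z : R) : `|z| `^ p <= t `^ p + t `^ (p - q0) * `|z| `^ q0.
    have [zt|tz] := leP `|z| t.
      rewrite -[leLHS]addr0 lerD ?mulr_ge0 ?powR_ge0// ge0_ler_powR ?nnegrE ?(ltW p_gt0)//.
      exact: ltW.
    rewrite -[leLHS]add0r lerD ?powR_ge0//.
    have -> : `|z| `^ p = `|z| `^ (p - q0) * `|z| `^ q0.
      by rewrite -powRD ?subrK// gt_eqF.
    rewrite ler_wpM2r ?powR_ge0// -[p - q0]opprB !powRN lef_pV2 ?posrE ?powR_gt0//.
      by rewrite ge0_ler_powR ?nnegrE ?(ltW t_gt0) ?(ltW tz)// ltW// subr_gt0.
    exact: lt_trans tz.
  apply: (le_trans (ler_sum _ (fun k _ => bound _))).
  rewrite big_split/= sumr_const card_ord -mulr_sumr -[_ *+ _]mulr_natl tp.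
  have : t `^ (p - q0) * \sum_i `|x ord0 i - y ord0 i| `^ q0 <= 4^-1.
    apply: (le_trans (ler_wpM2l (powR_ge0 _ _) xy)).
    rewrite tpq powRN powRM ?(ltW e0)// invfM mulfVK ?gt_eqF ?powR_gt0//.
    rewrite lef_pV2 ?posrE ?powR_gt0// le1r_powR//; first by rewrite ler1n.
    by rewrite (le_trans p1)// ltW.
  move: ne; lra.
move=> _ /= ne xy.
have : \sum_k `|x ord0 k - y ord0 k| `^ p <= n%:R * (4 * e) `^ p.
  rewrite mulr_natl -[n in leRHS]card_ord -sumr_const; apply: ler_sum => k _.
  rewrite ge0_ler_powR ?nnegrE ?(ltW p_gt0) ?(ltW e4)//.
  have := le_trans (le_bigmax _ (fun k => `|x ord0 k - y ord0 k|) k) xy.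
  move: e0; lra.
move: ne; lra.
Qed.

End exponents.
End norms.

Section metric_maps.
Context (R : realType).

Lemma diam_leP (X : metricType R) (A : set X) (e : R) :
  (diam A <= e%:E)%E <-> forall x y, A x -> A y -> mdist x y <= e.
Proof.
split=> [Ae x y Ax Ay|H].
  rewrite -lee_fin; apply: le_trans Ae; apply: ereal_sup_ubound.
  by exists (x, y).
by apply: ge_ereal_sup => _ [[x y] [Ax Ay] <-]; rewrite lee_fin H.
Qed.

Lemma metric_continuous (X : topologicalType) (Y : metricType R) (f : X -> Y) :
  (forall x e, 0 < e -> \forall y \near x, mdist (f x) (f y) < e) -> continuous f.
Proof.
move=> H x U /nbhs_ballP[e /= e0 eU]; apply: filterS (H x e e0) => y xy.
by apply: eU; rewrite ballEmdist.
Qed.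

Lemma isometry_continuous (X Y : metricType R) (f : X -> Y) :
  (forall x y, mdist (f x) (f y) = mdist x y) -> continuous f.
Proof.
move=> fI; apply: metric_continuous => x e e0; apply/nbhs_ballP; exists e => // y.
by rewrite ballEmdist /= fI.
Qed.

End metric_maps.

Section lower_bound.
Context (R : realType) (p : R) (q : \bar R) (p1 : 1 <= p) (pq : (p%:E < q)%E).
Local Notation r := (growth_exponent p q).
Local Notation B := (lp_ball p (exponent_ge1 p1 pq)).
Let q1 := exponent_ge1 p1 pq.
Let p1E : (1 <= p%:E)%E. Proof. by rewrite lee_fin. Qed.
Let p_gt0 : 0 < p. Proof. exact: lt_le_trans p1. Qed.

Lemma lp_norm_le1 n (x : 'rV[R]_n) :
  (lq_dist p%:E x 0 <= 1) = (\sum_k `|x ord0 k| `^ p <= 1).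
Proof.
rewrite lp_dist_le// powR1; congr (_ <= _).
by apply: eq_bigr => k _; rewrite [X in _ - X]mxE subr0.
Qed.

(** The norm [nu] is that of l^p although the ball is metrized by l^q. A simplex of dimension [k]
    has k + 1 vertices, so [norm_ball_dim] gives n + 1 <= k + 1. *)
Lemma embeds_in_dim_ge (e : R) n k : 0 < e ->
  n.+1%:R * (4 * e) `^ r <= 4^-1 -> embeds_in_dim (B n.+1) e k -> (n <= k)%N.
Proof.
move=> e_gt0 ne [V [K [[Kdim _] [f [fc ffib]]]]].
pose nu (x : 'rV[R]_n.+1) := lq_dist p%:E x 0.
have nuD x y : nu (x + y) <= nu x + nu y.
  apply: le_trans (lq_dist_triangle p1E y _ _) _.
  by rewrite lq_dist_sub addrK.
have nuZ w x : nu (w *: x) = `|w| * nu x by exact: lp_distZ.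
have nu_ge x : `|x| <= nu x.
  apply: norm_le_coord => [|i].
    by apply: le_trans (coord_le_lq_dist x 0 ord0 p1E).
  by apply: le_trans (coord_le_lq_dist x 0 i p1E); rewrite [X in _ - X]mxE subr0.
have nu_le x : nu x <= n.+1%:R * `|x|.
  by apply: le_trans (lq_dist_le_coord _ _ p1E) _; rewrite subr0.
have C_gt0 : 0 < n.+1%:R :> R by rewrite ltr0n.
pose rho := retract nu.
have rho1 x : \sum_k `|rho x ord0 k| `^ p <= 1.
  by rewrite -lp_norm_le1; exact: (nu_retract nuZ).
(* The embedding lives on the ball only; the retraction makes its coordinates continuous functions
   on the whole space. *)
pose b x : B n.+1 := LpBall _ (rho1 x).
have bc : continuous b.
  apply: metric_continuous => x d d_gt0.
  have := retract_continuous nuD nuZ nu_le C_gt0; rewrite continuous_dist.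
  move=> /(_ x (d / n.+1%:R)) [|c c_gt0 xc]; first by rewrite divr_gt0.
  apply/nbhs_ballP; exists c => // y; rewrite -ball_normE /= => xy.
  apply: le_lt_trans (lq_dist_le_coord _ _ q1) _.
  by rewrite mulrC -ltr_pdivlMr//; exact: xc.
pose u x v := f (b x) v.
rewrite -ltnS.
apply: (@norm_ball_dim R n nu n.+1%:R nuD nuZ nu_ge nu_le C_gt0 V u k.+1 (2^-1 `^ p^-1)).
- move=> v; have -> : u ^~ v = (fun y : polyhedron R V K => y v) \o (f \o b) by [].
  move=> x; apply: continuous_comp; last exact: bary_continuous.
  by apply: continuous_comp; [exact: bc | exact: fc].
- by move=> x v; rewrite bary_ge0 bary_le1.
- by move=> x; have [s Ks [sP _]] := bary_simplex (f (b x)); exists s => //; exact: Kdim.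
- have : (2^-1 : R) `^ p^-1 < 1 `^ p^-1.
    by apply: gt0_ltr_powR; rewrite ?invr_gt0 ?nnegrE// invf_lt1 ?ltr1n.
  by rewrite powR1.
- move=> x y x1 y1 uxy.
  rewrite /nu -lq_dist_sub; apply: lq_dist_lp_dist ne _ => //.
  have fxy : f (b x) = f (b y) by exact: bary_inj.
  have /diam_leP/(_ (b x) (b y)) := ffib (f (b y)).
  by rewrite /mdist/= /rho !retract_id//; apply.
Qed.

End lower_bound.

(** * Upper bound for the width dimension *)

Section skeleton.
Variables (V : finType) (j : nat).

(** Any weights with at most j + 1 nonzero entries define a point here, so no complex has to be
    tailored to the thresholding map. *)
Definition skeleton_simplices : set {fset V} :=
  [set s | s != fset0 /\ (#|` s| <= j.+1)%N].

Fact skeleton_neq0 : ~ skeleton_simplices fset0.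
Proof. by case; rewrite eqxx. Qed.

Fact skeleton_sub (s t : {fset V}) : skeleton_simplices s -> t != fset0 ->
  (t `<=` s)%fset -> skeleton_simplices t.
Proof.
by move=> [_ sj] t0 ts; split => //; exact: leq_trans (fsubset_leq_card ts) sj.
Qed.

Definition skeleton := SimplicialComplex skeleton_neq0 skeleton_sub.

Lemma skeleton_dimension : (j < #|V|)%N -> has_dimension skeleton j.
Proof.
move=> jV; split => [s []//|].
have cs : #|` [fset x in take j.+1 (enum V)]%fset| = j.+1.
  by rewrite card_fseq undup_id ?take_uniq ?enum_uniq// size_takel// -cardE.
exists [fset x in take j.+1 (enum V)]%fset => //; split; last by rewrite cs.
by rewrite -cardfs_gt0 cs.
Qed.

End skeleton.

Lemma sum_fset_support (R : realType) (V : finType) (s : {fset V}) (F : V -> R) :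
  (forall v, v \notin s -> F v = 0) -> \sum_(v <- s) F v = \sum_v F v.
Proof.
move=> Fs; rewrite big_uniq ?fset_uniq//= big_mkcond/=.
by apply: eq_bigr => v _; case: ifPn => // /Fs.
Qed.

(** There are finitely many faces, hence one neighbourhood good for all their radii. Near [x] the
    coordinates positive at [f x] stay positive, so [f x] lies in the closed face carrying [f z],
    and the radius of that face applies. *)
Lemma polyhedron_continuous (R : realType) (V : finType) (K : simplicial_complex V)
    (X : topologicalType) (f : X -> polyhedron R V K) :
  (forall v, continuous (fun x => f x v)) -> continuous f.
Proof.
move=> fc x U; rewrite nbhsE => -[A [oA Ax] AU].
have radius (s : {fset V}) : exists e : R, 0 < e /\
    (simplices K s -> closed_face s (f x) -> forall y, closed_face s y ->
      (forall v, v \in s -> `|f x v - y v| < e) -> A y).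
  have [[Ks sx]|sF] := pselect (simplices K s /\ closed_face s (f x)).
    by have [e e0 eA] := (oA : polyhedron_open A) s Ks (f x) sx Ax; exists e.
  by exists 1; split => // Ks sx; case: sF.
have [e eP] := choice radius.
have close : \forall z \near x, forall v, forall s, `|f x v - f z v| < e s.
  apply: filter_forall => v; apply: filter_forall => s.
  by have [e0 _] := eP s; move/cvgrPdist_lt : (fc v x); exact.
have support : \forall z \near x, forall v, 0 < f x v -> 0 < f z v.
  apply: filter_forall => v; have [xv|xv] := ltP 0 (f x v); last first.
    exact: nearW.
  have /cvgrPdist_lt/(_ _ xv) := fc v x; apply: filterS => z xz _.
  by move: xz; rewrite ltr_norml; lra.
apply: filterS2 close support => z zx zs; apply: AU.
have [s Ks [sz _]] := bary_simplex (f z).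
have [_ sA] := eP s; apply: sA => // v vs.
by apply/eqP; rewrite eq_le bary_ge0 andbT leNgt; apply/negP => /zs; rewrite (sz v vs) ltxx.
Qed.

Section skeleton_point.
Context (R : realType) (V : finType) (j : nat) (w : V -> R).
Hypotheses (w_ge0 : forall v, 0 <= w v) (w_sum : \sum_v w v = 1).
Hypothesis w_support : (#|[set v | w v != 0%R]%SET| <= j.+1)%N.

Lemma skeleton_bary : exists2 s, simplices (skeleton V j) s &
  (forall v, v \notin s -> w v = 0) /\ \sum_(v <- s) w v = 1.
Proof.
pose s := [fset v in enum [set v | w v != 0%R]%SET]%fset.
have sP v : (v \in s) = (w v != 0) by rewrite in_fset /= mem_enum inE.
have s0 v : v \notin s -> w v = 0 by rewrite sP negbK => /eqP.
exists s; last by split => //; rewrite sum_fset_support.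
split; last by rewrite card_fseq undup_id ?enum_uniq// -cardE.
apply/eqP => s_eq0; have := oner_eq0 R; rewrite -w_sum big1 ?eqxx// => v _.
by apply: s0; rewrite s_eq0 inE.
Qed.

Definition skeleton_point : polyhedron R V (skeleton V j) := Polyhedron w_ge0 skeleton_bary.

End skeleton_point.

Section upper_bound.
Context (R : realType) (p : R) (q : \bar R) (p1 : 1 <= p) (pq : (p%:E < q)%E).
Local Notation r := (growth_exponent p q).
Local Notation B := (lp_ball p (exponent_ge1 p1 pq)).
Let q1 := exponent_ge1 p1 pq.
Let p_gt0 : 0 < p. Proof. exact: lt_le_trans p1. Qed.

Lemma lp_ball_coord_continuous n i : continuous (fun x : B n => lp_val x ord0 i).
Proof.
move=> x; apply/(@cvgrPdist_lt R R^o (B n) (nbhs x) (nbhs_filter x)) => e e0.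
apply/nbhs_ballP; exists e => // y.
rewrite ballEmdist /=; apply: le_lt_trans.
exact: (coord_le_lq_dist (lp_val x) (lp_val y) i q1).
Qed.

Section threshold.
Variables (n : nat) (t : R).
Hypothesis t_gt0 : 0 < t.
Local Notation V := (option ('I_n * bool)).

(* The positive and negative parts of the coordinates, soft-thresholded at
   height t; the factor makes their sum at most 1. *)
Definition excess (x : 'rV[R]_n) (i : 'I_n) (b : bool) : R :=
  Num.max 0 ((-1) ^+ b * x ord0 i - t) / n.+1%:R.

(** The vertex [None] absorbs the remaining weight; it is the one vertex in excess of the number of
    large coordinates, matching j + 1 vertices for dimension [j]. *)
Definition threshold (x : 'rV[R]_n) (v : V) : R :=
  if v is Some (i, b) then excess x i b else 1 - \sum_i (excess x i true + excess x i false).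

Lemma excess_ge0 x i b : 0 <= excess x i b.
Proof. by rewrite divr_ge0// le_max lexx. Qed.

Lemma excess_neq0 x i b : excess x i b != 0 -> t < (-1) ^+ b * x ord0 i.
Proof.
apply: contraNT; rewrite -leNgt => xt; rewrite /excess max_l ?mul0r//.
by rewrite subr_le0.
Qed.

Lemma excess_sum (x : 'rV[R]_n) i : `|x ord0 i| <= 1 ->
  excess x i true + excess x i false <= n.+1%:R^-1.
Proof.
move=> x1; rewrite -mulrDl -[leRHS]mul1r ler_pM2r ?invr_gt0//.
move: x1; rewrite expr1 expr0 mulN1r mul1r ler_norml /Num.max.
by move=> /andP[? ?]; case: (ltP 0 (- _ - t)) => ?; case: (ltP 0 (_ - t)) => ?; move: t_gt0; lra.
Qed.

End threshold.

Lemma embeds_in_dim_le (e : R) n : 0 < e ->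
  exists2 k, embeds_in_dim (B n) e k & k%:R <= (e / 2) `^ (- r).
Proof.
move=> e_gt0; have e2_gt0 : 0 < e / 2 by rewrite divr_gt0.
pose t := (e / 2) `^ (r / p).
have t_gt0 : 0 < t by rewrite powR_gt0.
pose k0 := Num.truncn ((e / 2) `^ (- r)).
have k0P : k0%:R <= (e / 2) `^ (- r) by rewrite truncn_le powR_ge0.
(* There are 2n + 1 vertices, so the skeleton has dimension exactly [j] only for [j] up to 2n. The
   halved [e] is for the two points of a fibre, each moved by at most e / 2. *)
pose j := minn k0 (n * 2).
exists j; last first.
  by apply: le_trans k0P; rewrite ler_nat geq_minl.
have xp_le (x : B n) : \sum_i `|lp_val x ord0 i| `^ p <= 1 by exact: lp_valP.
have coord1 (x : B n) i : `|lp_val x ord0 i| <= 1.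
  have /(le_trans (coord_le_lq_dist _ 0 i _)) : lq_dist p%:E (lp_val x) 0 <= 1.
    by rewrite lp_norm_le1.
  by rewrite [X in _ - X]mxE subr0 lee_fin; exact.
(* Each coordinate above [t] contributes at least t^p = (e / 2)^r to a sum that is at most 1. *)
have few_large (x : B n) : (#|[set i | (t < `|lp_val x ord0 i|)%R ]%SET| <= k0)%N.
  rewrite truncn_ge_nat ?powR_ge0// powRN -[leRHS]mul1r ler_pdivlMr ?powR_gt0//.
  have -> : (e / 2) `^ r = t `^ p by rewrite -powRrM divfK// gt_eqF.
  apply: le_trans (xp_le x); rewrite mulr_natl -sumr_const.
  rewrite [leRHS](bigID (mem [set i | (t < `|lp_val x ord0 i|)%R ]%SET))/=.
  rewrite -[leLHS]addr0 lerD//; last by apply: sumr_ge0 => *; exact: powR_ge0.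
  apply: ler_sum => i; rewrite inE => ti.
  by rewrite ge0_ler_powR ?nnegrE ?(ltW p_gt0) ?(ltW t_gt0) ?(ltW ti).
pose w (x : B n) := threshold t (lp_val x).
have w_ge0 x v : 0 <= w x v.
  case: v => [[i b]|] /=; first exact: excess_ge0.
  rewrite subr_ge0; apply: (le_trans (ler_sum _ (fun i _ => excess_sum t_gt0 (coord1 x i)))).
  by rewrite sumr_const card_ord -[_ *+ _]mulr_natl ler_pdivrMr ?ltr0n// mul1r ler_nat.
have w_sum x : \sum_v w x v = 1.
  have E : \sum_i (excess t (lp_val x) i true + excess t (lp_val x) i false) =
      \sum_v excess t (lp_val x) v.1 v.2.
    under eq_bigr do rewrite -(big_bool _ (excess t (lp_val x) _)).
    by rewrite pair_bigA.
  rewrite (bigD1 None)//= (reindex_omap Some id) => [|[?|]//] /=.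
  rewrite E addrC -[RHS](subrK (\sum_v excess t (lp_val x) v.1 v.2)) addrC; congr (_ + _).
  by apply: eq_big => [v|[]//]; rewrite /= ?eqxx.
have w_support x : (#|[set v | w x v != 0%R]%SET| <= j.+1)%N.
  pose A := ([set v | w x v != 0%R] :\ None)%SET.
  rewrite (cardsD1 None) -/A -addn1 addnC leq_add//; last by case: (_ \in _).
  rewrite leq_min; apply/andP; split; last first.
    rewrite -[n in leqRHS]card_ord -card_bool -card_prod -cardsT.
    rewrite -[leqRHS](card_imset _ (@Some_inj _)); apply/subset_leq_card/fintype.subsetP => -[v|].
      by move=> _; apply: imset_f.
    by rewrite !inE.
  have NA : None \notin A by rewrite !inE.
  have AP i b : Some (i, b) \in A -> t < (-1) ^+ b * lp_val x ord0 i.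
    by rewrite !inE; exact: excess_neq0.
  apply: leq_trans (few_large x).
  (* A coordinate cannot exceed [t] with both signs, so forgetting the sign is injective on [A]. *)
  rewrite -(card_in_imset (f := omap fst) (D := A)); last first.
    move=> [[i b]|] [[i' b']|] //=; rewrite ?(negbTE NA)//.
    move=> /AP + /AP + [ii']; rewrite -ii' => xb xb'.
    suff -> : b = b' by [].
    by move: b b' xb xb' => [] []; rewrite ?expr0 ?expr1 ?mulN1r ?mul1r//; move: t_gt0; lra.
  rewrite -[leqRHS](card_imset _ (@Some_inj _)).
  apply/subset_leq_card/fintype.subsetP => _ /imsetP[[[i b]|] /= vA ->]; last first.
    by rewrite (negbTE NA) in vA.
  apply: imset_f; rewrite inE; apply: lt_le_trans (AP _ _ vA) _.
  by rewrite (le_trans (ler_norm _))// normrMsign.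
pose f (x : B n) := skeleton_point (w_ge0 x) (w_sum x) (w_support x).
exists (option ('I_n * bool) : finType), (skeleton (option ('I_n * bool) : finType) j); split.
  apply: skeleton_dimension; rewrite card_option card_prod card_ord card_bool ltnS.
  exact: geq_minr.
exists f; split.
  have excess_continuous i b : continuous (fun x : B n => excess t (lp_val x) i b).
    pose h (x : B n) := (-1) ^+ b * lp_val x ord0 i - t.
    have hc : continuous h.
      move=> x; apply: (@cvgB R R^o _ (nbhs x) _
        (fun y : B n => (-1) ^+ b * lp_val y ord0 i) (cst t)); last exact: cvg_cst.
      apply: (@cvgM R (B n) (nbhs x) _ (cst ((-1) ^+ b)) (fun y : B n => lp_val y ord0 i)).
        exact: cvg_cst.
      exact: lp_ball_coord_continuous.
    move=> x; apply: (@cvgM R (B n) (nbhs x) _ (fun y => Num.max 0 (h y))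
      (cst n.+1%:R^-1)); last exact: cvg_cst.
    by apply: (@continuous_max R (B n) (cst 0) h x); [exact: cst_continuous | exact: hc].
  apply: polyhedron_continuous => -[[i b]|]; first exact: excess_continuous.
  move=> x; apply: (@cvgB R R^o _ (nbhs x) _ (cst 1)
    (fun y : B n => \sum_i (excess t (lp_val y) i true + excess t (lp_val y) i false))).
    exact: cvg_cst.
  apply: (@cvg_big R^o _ +%R 0 predT add_continuous) => i _.
  apply: (@cvgD R R^o _ (nbhs x) _ (fun y : B n => excess t (lp_val y) i true)
    (fun y : B n => excess t (lp_val y) i false)); exact: excess_continuous.
move=> y; apply/diam_leP => x x' <- /(congr1 (fun z : polyhedron _ _ _ => bary z)) xx'.
(* The part that thresholding discards. What remains, z - clip z, is determined by the two excesses,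
   so points of one fibre differ only by their clipped parts. *)
pose clip (z : R) := Num.max (- t) (Num.min t z).
pose c (x : B n) : 'rV[R]_n := \row_i clip (lp_val x ord0 i).
have clipP z : `|clip z| <= `|z| /\ `|clip z| <= t.
  rewrite /clip /Num.max /Num.min; have [z0|z0] := leP 0 z.
    rewrite (ger0_norm z0) !ler_norml; case: (ltP t z) => ?; case: ltP => ?;
      split; apply/andP; split; move: t_gt0; lra.
  rewrite (ltr0_norm z0) !ler_norml; case: (ltP t z) => ?; case: ltP => ?;
    split; apply/andP; split; move: t_gt0; lra.
have clipE z : z - clip z = Num.max 0 (z - t) - Num.max 0 (- z - t).
  rewrite /clip /Num.max /Num.min; case: (ltP t z) => ?; do 3 (case: ltP => ?); move: t_gt0; lra.
have clip_eq i : lp_val x ord0 i - lp_val x' ord0 i = c x ord0 i - c x' ord0 i.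
  rewrite 2!mxE; suff : lp_val x ord0 i - clip (lp_val x ord0 i) =
    lp_val x' ord0 i - clip (lp_val x' ord0 i) by lra.
  have n1 : n.+1%:R^-1 != 0 :> R by rewrite invr_eq0 pnatr_eq0.
  have eb b := mulIf n1 (congr1 (fun z => z (Some (i, b))) xx').
  rewrite !clipE; have /= := eb true; have /= := eb false.
  by rewrite expr0 expr1 !mul1r !mulN1r => -> ->.
have c_small (x0 : B n) : lq_dist q (c x0) 0 <= e / 2.
  apply: (truncation_lq_dist p1 pq e2_gt0 (xp_le x0)) => i; rewrite mxE.
  exact: clipP.
rewrite /mdist /= lq_dist_sub.
have -> : lp_val x - lp_val x' = c x - c x'.
  by apply/rowP => i; rewrite 2!mxE clip_eq [RHS]mxE [X in _ = _ + X]mxE.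
rewrite -lq_dist_sub (le_trans (lq_dist_triangle q1 0 _ _))//.
by rewrite [X in _ + X](lq_distC q1) [leRHS]splitr lerD.
Qed.

End upper_bound.

(** * Growth of the width dimension *)

Section widim_facts.
Context (R : realType).

Lemma widim_isometry (X Y : metricType R) (g : X -> Y) (e : R) :
  (forall x y, mdist (g x) (g y) = mdist x y) -> (widim X e <= widim Y e)%E.
Proof.
move=> gI; apply: ereal_inf_le_tmp => _ [k [V [K [Kk [f [fc ffib]]]]] <-]; exists k => //.
exists V, K; split => //; exists (f \o g); split.
  by move=> x; apply: continuous_comp; [exact: isometry_continuous | exact: fc].
by move=> y; apply/diam_leP => x x' fx fx'; rewrite -gI; apply: (diam_leP _ _).1 (ffib y) _ _ _ _.
Qed.

Lemma widim_ge0 (X : metricType R) (e : R) : (0 <= widim X e)%E.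
Proof. by apply: le_ereal_inf_tmp => _ [k _ <-]; rewrite lee_fin. Qed.

Lemma cvg_div_norm_ln (C : R) : C / `|ln e| @[e --> 0^'+] --> 0.
Proof.
apply/cvgrPdist_lt => d d_gt0; near=> e.
have e_gt0 : 0 < e by near: e; exact: nbhs_right_gt.
have : e < expR (- (`|C| / d)) by near: e; apply: nbhs_right_lt; exact: expR_gt0.
rewrite -ltr_ln ?posrE ?expR_gt0// expRK => le.
have Cd : 0 <= `|C| / d by rewrite divr_ge0// ltW.
have e1 : `|C| / d < `|ln e|.
  have ln0 : ln e < 0 by rewrite (lt_le_trans le)// oppr_le0.
  by rewrite (ltr0_norm ln0) ltrNr.
rewrite sub0r normrN normrM normfV normr_id ltr_pdivrMr; last exact: le_lt_trans e1.
by rewrite mulrC -ltr_pdivrMr.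
Unshelve. all: by end_near. Qed.

End widim_facts.

Section lp_balls.
Context (R : realType) (p : R) (q : \bar R) (p1 : 1 <= p) (pq : (p%:E < q)%E).
Local Notation r := (growth_exponent p q).
Local Notation B := (lp_ball p (exponent_ge1 p1 pq)).
Let q1 := exponent_ge1 p1 pq.
Let p_gt0 : 0 < p. Proof. exact: lt_le_trans p1. Qed.

Definition pad0 n (x : 'rV[R]_n) : 'rV[R]_n.+1 :=
  \row_j (if unlift ord0 j is Some i then x ord0 i else 0).

Lemma pad0_ord0 n (x : 'rV[R]_n) : pad0 x ord0 ord0 = 0.
Proof. by rewrite mxE unlift_none. Qed.

Lemma pad0_lift n (x : 'rV[R]_n) i : pad0 x ord0 (lift ord0 i) = x ord0 i.
Proof. by rewrite mxE liftK. Qed.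

Lemma pad0_lp_ball n (x : B n) : \sum_k `|pad0 x ord0 k| `^ p <= 1.
Proof.
rewrite big_ord_recl pad0_ord0 normr0 powR0 ?gt_eqF// add0r.
by under eq_bigr do rewrite pad0_lift; exact: lp_valP.
Qed.

Lemma lq_dist_pad0 n (x y : 'rV[R]_n) : lq_dist q (pad0 x) (pad0 y) = lq_dist q x y.
Proof.
have E i : pad0 x ord0 (lift ord0 i) - pad0 y ord0 (lift ord0 i) = x ord0 i - y ord0 i.
  by rewrite !pad0_lift.
rewrite /lq_dist; case: q q1 => [q0| |]//= h.
  have q0_gt0 : 0 < q0 by rewrite -lte_fin (lt_le_trans _ h)// lte01.
  rewrite big_ord_recl !pad0_ord0 subrr normr0 powR0 ?gt_eqF// add0r.
  by rewrite (eq_bigr (fun i => `|x ord0 i - y ord0 i| `^ q0)) => [//|i _]; rewrite E.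
rewrite big_ord_recl !pad0_ord0 subrr normr0 max_r; last exact: bigmax_ge_id.
by rewrite (eq_bigr (fun i => `|x ord0 i - y ord0 i|)) => [//|i _]; rewrite E.
Qed.

Lemma widim_lp_ball_nd (e : R) : nondecreasing_seq (fun n => widim (B n) e).
Proof.
apply/nondecreasing_seqP => n.
apply: (@widim_isometry _ (B n) (B n.+1) (fun x => LpBall _ (pad0_lp_ball x))) => x y.
exact: lq_dist_pad0.
Qed.

Lemma widim_lp_ball_le (e : R) n : 0 < e -> (widim (B n) e <= ((e / 2) `^ (- r))%:E)%E.
Proof.
move=> e0; have [k ke kr] := embeds_in_dim_le p1 pq n e0.
apply: (@le_trans _ _ k%:R%:E); last by rewrite lee_fin.
by apply: ereal_inf_lbound; exists k.
Qed.

Lemma widim_lp_ball_ge (e : R) n : 0 < e -> n.+1%:R * (4 * e) `^ r <= 4^-1 ->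
  (n%:R%:E <= widim (B n.+1) e)%E.
Proof.
move=> e0 ne; apply: le_ereal_inf_tmp => _ [k ke <-].
by rewrite lee_fin ler_nat; exact: embeds_in_dim_ge ke.
Qed.

Lemma lne_widim_nd (e : R) : nondecreasing_seq (fun n => lne (widim (B n) e)).
Proof.
move=> m n mn; rewrite lee_lne ?in_itv/= ?widim_ge0 ?leey//.
exact: widim_lp_ball_nd.
Qed.

Lemma lne_widim_div_nd (e c : R) : 0 < c ->
  nondecreasing_seq (fun n => (lne (widim (B n) e) / c%:E)%E).
Proof.
move=> c_gt0 m n mn; apply: lee_wpmul2r; last exact: lne_widim_nd.
by rewrite inver gt_eqF// lee_fin invr_ge0 ltW.
Qed.

Lemma lim_widim_le (e : R) : 0 < e < 1 ->
  (limn (fun n => lne (widim (B n) e) / `|ln e|%:E) <=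
   (r + r * ln 2 / `|ln e|)%:E)%E.
Proof.
move=> /andP[e_gt0 e_lt1]; have ln_lt0 : ln e < 0 by rewrite -ln1 ltr_ln ?posrE.
have c_gt0 : 0 < `|ln e| by rewrite normr_gt0 lt_eqF.
apply: lime_le; first exact/ereal_nondecreasing_is_cvgn/lne_widim_div_nd.
apply: nearW => n.
have e2 : 0 < (e / 2) `^ (- r) by rewrite powR_gt0// divr_gt0.
apply: (@le_trans _ _ ((ln ((e / 2) `^ (- r)))%:E / `|ln e|%:E)%E).
  apply: lee_wpmul2r; first by rewrite inver gt_eqF// lee_fin invr_ge0 ltW.
  rewrite -lne_EFin// lee_lne ?in_itv/= ?widim_ge0 ?leey ?lee_fin ?(ltW e2)//.
  exact: widim_lp_ball_le.
rewrite inver gt_eqF// -EFinM lee_fin ln_powR ln_div ?posrE// ltr0_norm//.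
by rewrite le_eqVlt; apply/orP; left; apply/eqP; field; rewrite ?oppr_eq0 lt_eqF.
Qed.

(** By monotonicity one value of the dimension suffices: the integer part n + 1 of x = (4e)^-r / 4,
    the largest that the lower bound allows. The smallness of [e] gives x >= 4, hence n > x - 2 >= x
    / 2, and ln (x / 2) = r |ln e| - (r ln 4 + ln 8). *)
Lemma lim_widim_ge (e : R) : 0 < e < 1 -> (4 * e) `^ r <= 16^-1 ->
  ((r - (r * ln 4 + ln 8) / `|ln e|)%:E <=
   limn (fun n => lne (widim (B n) e) / `|ln e|%:E))%E.
Proof.
move=> /andP[e_gt0 e_lt1] e16; have ln_lt0 : ln e < 0 by rewrite -ln1 ltr_ln ?posrE.
have c_gt0 : 0 < `|ln e| by rewrite normr_gt0 lt_eqF.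
have e4 : 0 < (4 * e) `^ r by rewrite powR_gt0// mulr_gt0.
have e4V : 0 < ((4 * e) `^ r)^-1 by rewrite invr_gt0.
pose x := ((4 * e) `^ r)^-1 / 4.
have x_ge4 : 4 <= x.
  rewrite /x ler_pdivlMr// -[leLHS]invrK lef_pV2 ?posrE ?invr_gt0 ?mulr_gt0//.
  by apply: le_trans e16 _; rewrite lef_pV2 ?posrE ?mulr_gt0//; lra.
pose n := (Num.truncn x).-1.
have nE : n.+1 = Num.truncn x by rewrite prednK// truncn_gt0; lra.
have [nx xn] : n.+1%:R <= x /\ x < n.+2%:R.
  by rewrite nE; have /truncn_itv/andP[] : 0 <= x by lra.
have n_ge : x / 2 <= n%:R.
  move: xn x_ge4; rewrite -natr1 -[n.+1%:R]natr1; clearbody x.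
  by move: (n%:R : R) => y; lra.
have n_gt0 : 0 < n%:R :> R by lra.
have ne : n.+1%:R * (4 * e) `^ r <= 4^-1.
  by rewrite -ler_pdivlMr// mulrC.
apply: lime_ge; first exact/ereal_nondecreasing_is_cvgn/lne_widim_div_nd.
exists n.+1 => // m /= nm; have := @lne_widim_div_nd e _ c_gt0 _ _ nm; apply: le_trans.
apply: (@le_trans _ _ ((ln (x / 2))%:E / `|ln e|%:E)%E).
  rewrite inver gt_eqF// -EFinM lee_fin ler_pdivlMr//.
  rewrite mulrBl divfK ?gt_eqF// /x !ln_div ?posrE ?invr_gt0 ?divr_gt0//.
  rewrite lnV ?posrE// ln_powR lnM ?posrE// ltr0_norm//.
  have -> : 8 = 4 * 2 :> R by ring.
  rewrite [ln (4 * 2)]lnM ?posrE//; lra.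
apply: lee_wpmul2r; first by rewrite inver gt_eqF// lee_fin invr_ge0 ltW.
apply: (@le_trans _ _ (lne n%:R%:E)).
  by rewrite lne_EFin// lee_fin ler_ln ?posrE ?divr_gt0//; lra.
rewrite lee_lne ?in_itv/= ?widim_ge0 ?leey ?lee_fin ?ler0n//.
exact: widim_lp_ball_ge.
Qed.

End lp_balls.

Unset Implicit Arguments.
Set Strict Implicit.

Theorem corollary1p3 (R : realType) (p : R) (q : \bar R)
    (hp : 1 <= p) (hpq : (p%:E < q)%E) :
  let W (eps : R) (n : nat) : \bar R :=
    widim (lp_ball p (exponent_ge1 hp hpq) n) eps in
  (forall eps : R, 0 < eps ->
    [/\ nondecreasing_seq (W eps),
        exists M : nat, forall n : nat, (W eps n <= M%:R%:E)%E
      & cvgn (fun n : nat => lne (W eps n))]) /\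
  ((fun eps : R => limn (fun n : nat => (lne (W eps n) / `|ln eps|%:E)%E))
     @ 0^'+ --> (growth_exponent p q)%:E).
Proof.
set r := growth_exponent p q.
have r_gt0 : 0 < r by exact: growth_exponent_gt0.
move=> W; split=> [e e_gt0|].
  split; first exact: widim_lp_ball_nd.
    exists (Num.truncn ((e / 2) `^ (- r))).+1 => n.
    apply: le_trans (widim_lp_ball_le hp hpq n e_gt0) _.
    by rewrite lee_fin ltW// truncnS_gt.
  exact/ereal_nondecreasing_is_cvgn/lne_widim_nd.
apply: (@squeeze_cvge _ _ _ _ (fun e => (r - (r * ln 4 + ln 8) / `|ln e|)%:E) _
   (fun e => (r + r * ln 2 / `|ln e|)%:E)).
- near=> e.
  have e_gt0 : 0 < e by near: e; exact: nbhs_right_gt.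
  have e_lt1 : e < 1 by near: e; exact: nbhs_right_lt.
  (* This is (4e)^r < 1/16 solved for [e]. *)
  have e_small : e < 16^-1 `^ r^-1 / 4.
    by near: e; apply: nbhs_right_lt; rewrite divr_gt0// powR_gt0 ?invr_gt0.
  apply/andP; split; last by apply: lim_widim_le; rewrite e_gt0.
  apply: lim_widim_ge; first by rewrite e_gt0.
  have -> : 16^-1 = (16^-1 `^ r^-1) `^ r :> R.
    by rewrite -powRrM mulVf ?gt_eqF// powRr1.
  rewrite ge0_ler_powR ?nnegrE ?powR_ge0 ?(ltW r_gt0) ?mulr_ge0 ?(ltW e_gt0)//.
  by move: e_small; rewrite ltr_pdivlMr//; lra.
- apply/fine_cvgP; split; first exact: nearW.
  rewrite -[X in _ --> X]subr0; apply: cvgB; first exact: cvg_cst.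
  exact: cvg_div_norm_ln.
- apply/fine_cvgP; split; first exact: nearW.
  rewrite -[X in _ --> X]addr0; apply: cvgD; first exact: cvg_cst.
  exact: cvg_div_norm_ln.
Unshelve. all: by end_near. Qed.
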